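(* Let either the sign be $+$ and $n\ge2$ even, or the sign be $-$ and $n\ge3$ odd; put $\eta=\pm1$ accordingly, and write $A=A_2^{\pm}(n,q)$, $B=B_2^{\pm}(n,q)$, $N=N_2^{\pm}(n,q)=|DC_2^{\pm}(n,q)|$. Then $N=AB$ and for every integer $h\ge1$, $$\eta^h\,SK^{2h}=-\sum_{l=0}^{h-1}\eta^l\binom hl B^{\,h-l}SK^{2l}+qA^{-h}\sum_{j=0}^{\min\{N,h\}}(-1)^jC_j\sum_{t=j}^h t!\,S(h,t)\,3^{h-t}2^{t-h-j-1}\binom{N-j}{N-t},$$ where $\{C_j\}_{j=0}^N$ is the weight distribution of the ternary code $C(DC_2^{\pm}(n,q))$.
   Context: Let $q=3^s$, $\mathrm{tr}:\mathbb F_q\to\mathbb F_3$ the absolute trace, $\lambda(x)=e^{2\pi i\,\mathrm{tr}(x)/3}$. $K(\psi;a)=\sum_{\alpha\in\mathbb F_q^*}\psi(\alpha+a\alpha^{-1})$. For $h\ge0$, $SK^h=\sum_{a\in\mathbb F_q^*,\,a\text{ square}}K(\lambda;a)^h$. $S(h,t)=\frac1{t!}\sum_{j=0}^t(-1)^{t-j}\binom tj j^h$. Fix a nonsquare $\epsilon\in\mathbb F_q^*$, $\delta_\epsilon=\mathrm{diag}(1,-\epsilon)$, $J=\begin{bmatrix}0&1_{n-1}&0\\1_{n-1}&0&0\\0&0&\delta_\epsilon\end{bmatrix}$, $O^-(2n,q)=\{w\in GL(2n,q):{}^twJw=J\}$, $SO^-(2n,q)$ its determinant-one subgroup. $Q=Q(2n,q)$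 is the set of products $\begin{bmatrix}A&0&0\\0&{}^tA^{-1}&0\\0&0&i\end{bmatrix}\begin{bmatrix}1_{n-1}&B&-{}^th\delta_\epsilon\\0&1_{n-1}&0\\0&h&1_2\end{bmatrix}$ with $A\in GL(n-1,q)$, $i\in SO^-(2,q)$, ${}^tB+B+{}^th\delta_\epsilon h=0$ ($B$ of size $(n-1)\times(n-1)$, $h$ of size $2\times(n-1)$). For $0\le r\le n-1$, $\sigma_r=\begin{bmatrix}0&0&1_r&0&0\\0&1_{n-1-r}&0&0&0\\1_r&0&0&0&0\\0&0&0&1_{n-1-r}&0\\0&0&0&0&1_2\end{bmatrix}$. $DC_2^{\pm}(n,q)=Q\sigma_{n-2}Q=\{x\sigma_{n-2}y:x,y\in Q\}$ (sign $+$ for $n$ even, $-$ for $n$ odd). Constants (empty products $=1$, $\left[{m\atop 1}\right]_q=\frac{q^m-1}{q-1}$): $A_2^+(n,q)=q^{(5n^2-2n-8)/4}\left[{n-1\atop1}\right]_q\prod_{j=1}^{(n-2)/2}(q^{2j-1}-1)$, $B_2^+(n,q)=(q+1)q^{(n-2)^2/4}(q^{n-1}-1)\prod_{j=1}^{(n-2)/2}(q^{2j}-1)$; $A_2^-(n,q)=q^{(5n^2-4n-5)/4}\left[{n-1\atop1}\right]_q\prod_{j=1}^{(n-1)/2}(q^{2j-1}-1)$, $B_2^-(n,q)=(q+1)q^{(n-1)^2/4}\prod_{j=1}^{(n-1)/2}(q^{2j}-1)$. Code: fix an ordering $g_1,\dots,g_N$ of $D=DC_2^{\pm}(n,q)$;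 $C(D)=\{u\in\mathbb F_3^N:\sum_j u_j\mathrm{Tr}(g_j)=0\text{ in }\mathbb F_q\}$ ($\mathrm{Tr}$ = matrix trace); $C_j$ = number of codewords of Hamming weight $j$. *)

(* Defs.v *)
From HB Require Import structures.
From mathcomp Require Import all_boot all_order all_algebra all_field.
Import Order.TTheory GRing.Theory Num.Theory.

(* [m over 1]_q = (q^m - 1)/(q - 1) (exact division). *)
Definition gauss1 (m q : nat) : nat := ((q ^ m - 1) %/ (q - 1))%N.

Definition A2plus (n q : nat) : nat :=
  (q ^ ((5 * n ^ 2 - 2 * n - 8) %/ 4) * gauss1 (n - 1) q *
   \prod_(1 <= j < ((n - 2) %/ 2).+1) (q ^ (2 * j - 1) - 1))%N.
Definition B2plus (n q : nat) : nat :=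
  ((q + 1) * q ^ ((n - 2) ^ 2 %/ 4) * (q ^ (n - 1) - 1) *
   \prod_(1 <= j < ((n - 2) %/ 2).+1) (q ^ (2 * j) - 1))%N.
Definition A2minus (n q : nat) : nat :=
  (q ^ ((5 * n ^ 2 - 4 * n - 5) %/ 4) * gauss1 (n - 1) q *
   \prod_(1 <= j < ((n - 1) %/ 2).+1) (q ^ (2 * j - 1) - 1))%N.
Definition B2minus (n q : nat) : nat :=
  ((q + 1) * q ^ ((n - 1) ^ 2 %/ 4) *
   \prod_(1 <= j < ((n - 1) %/ 2).+1) (q ^ (2 * j) - 1))%N.

Definition A2 (n q : nat) : nat := if odd n then A2minus n q else A2plus n q.
Definition B2 (n q : nat) : nat := if odd n then B2minus n q else B2plus n q.

Local Open Scope ring_scope.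

Definition omega3 : algC := (-1 + 'i * sqrtC 3%:R) / 2%:R.

Definition stirling2 (h t : nat) : algC :=
  (t`!%:R)^-1 * \sum_(j < t.+1) (-1) ^+ (t - j) * ('C(t, j))%:R * (j%:R) ^+ h.

Section FiniteField.
Context {F : finFieldType}.

Definition sdeg : nat := logn 3 #|F|.

(* absolute trace F_q -> F_3 (values in the prime subfield of F) *)
Definition abstr (x : F) : F := \sum_(i < sdeg) x ^+ (3 ^ i).

(* canonical additive character lambda(x) = exp(2 pi i tr(x)/3) *)
Definition lambda (x : F) : algC :=
  if abstr x == 0 then 1 else if abstr x == 1 then omega3 else omega3 ^+ 2.

Definition Kloos (a : F) : algC := \sum_(al : F | al != 0) lambda (al + a / al).

Definition is_square (a : F) : bool := [exists b : F, a == b ^+ 2].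

Definition SK (h : nat) : algC :=
  \sum_(a : F | (a != 0) && is_square a) Kloos a ^+ h.

Definition blk3 (m : nat)
  (a b : 'M[F]_(m, m)) (c : 'M[F]_(m, 2))
  (d e : 'M[F]_(m, m)) (f : 'M[F]_(m, 2))
  (g h : 'M[F]_(2, m)) (i : 'M[F]_2) : 'M[F]_(m + m + 2) :=
  block_mx (block_mx a b d e) (col_mx c f) (row_mx g h) i.

Definition delta (eps : F) : 'M[F]_2 :=
  \matrix_(i < 2, j < 2) (if i == j then (if (i : nat) == 0%N then 1 else - eps) else 0).

(* J, of size 2n = (n-1)+(n-1)+2, here with m = n-1 *)
Definition Jmat (eps : F) (m : nat) : 'M[F]_(m + m + 2) :=
  blk3 m 0 1%:M 0 1%:M 0 0 0 0 (delta eps).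

Definition in_Ominus (eps : F) (m : nat) (w : 'M[F]_(m + m + 2)) : bool :=
  (w \in unitmx) && (w^T *m Jmat eps m *m w == Jmat eps m).
Definition in_SO2minus (eps : F) (i : 'M[F]_2) : bool :=
  [&& i \in unitmx, i^T *m delta eps *m i == delta eps & \det i == 1].

Definition in_Q (eps : F) (m : nat) (w : 'M[F]_(m + m + 2)) : bool :=
  [exists A : 'M[F]_m, exists i : 'M[F]_2, exists B : 'M[F]_m, exists h : 'M[F]_(2, m),
    [&& A \in unitmx, in_SO2minus eps i,
        B^T + B + h^T *m delta eps *m h == 0 &
        w == blk3 m A 0 0 0 (invmx A)^T 0 0 0 i *m
             blk3 m 1%:M B (- (h^T *m delta eps)) 0 1%:M 0 0 h 1%:M]].

Definition Qset (eps : F) (m : nat) : {set 'M[F]_(m + m + 2)} := [set w | in_Q eps m w].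

(* sigma_r (block sizes r, m-r, r, m-r, 2), m = n-1 *)
Definition sigma (m r : nat) : 'M[F]_(m + m + 2) :=
  \matrix_(i, j)
    (if [|| ((i < r)%N && ((j : nat) == i + m)%N),
            (((m <= i)%N && (i < m + r)%N) && ((i : nat) == j + m)%N)
          | (~~ ((i < r)%N || ((m <= i)%N && (i < m + r)%N)) && (i == j))]
     then 1 else 0).

(* DC_2^{+-}(n,q) = Q sigma_{n-2} Q, with m = n-1 (so n-2 = m-1) *)
Definition DC2 (eps : F) (m : nat) : {set 'M[F]_(m + m + 2)} :=
  [set x *m sigma m m.-1 *m y | x in Qset eps m, y in Qset eps m].

Definition F3toF (u : 'F_3) : F := (nat_of_ord u)%:R.

(* weight distribution C_j of the ternary code C(DC): codewords are indexed by
   the elements of DC (equivalently, by an ordering g_1..g_N of DC) *)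
Definition codeC (eps : F) (m j : nat) : nat :=
  #|[set u : {ffun 'M[F]_(m + m + 2) -> 'F_3} |
      [&& [forall g, (g \notin DC2 eps m) ==> (u g == 0)],
          \sum_(g in DC2 eps m) F3toF (u g) * \tr g == 0 &
          #|[set g | u g != 0]| == j]]|.

End FiniteField.

(* Main.v *)
(** For a in F_q^* put S(a) = sum over g in DC = Q sigma Q of lambda(a Tr g). Every
    element of DC is x sigma y for equally many pairs (x, y), and Tr (x sigma y) =
    Tr (y x sigma), so S(a) is a constant times the sum over w in Q of
    lambda(a Tr (w sigma)). In the coordinates (A, i, h, S) of Q, where B =
    h^T delta h + S with S skew (in characteristic 3 this solves
    B^T + B + h^T delta h = 0), the sum over S forces A to be block lower triangular
    with a symmetric block X of size n-2; the sum over i is -K(a^2), the sum over the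
    last diagonal entry of A is K(a^2), and X contributes the Gauss sums of
    delta (x) X, which are (-q)^(n-2) since x^2 - eps y^2 is anisotropic. Hence
    S(a) = -eta A K(a^2)^2 and the word (tr (a Tr g))_g has weight
    (2/3) A (B + eta K(a^2)^2). The recursion follows by comparing the h-th power
    moment of these weights with the binomial moments supplied by MacWilliams duality. *)

Require Import Defs.
From HB Require Import structures.
From mathcomp Require Import all_boot all_order all_fingroup all_solvable all_algebra all_field.
From mathcomp Require Import ring zify.
Import Order.TTheory GRing.Theory Num.Theory.
Local Open Scope ring_scope.
Set Implicit Arguments.
Unset Strict Implicit.

(** * Additive characters *)

(** The minus signs in -K(a^2) and in the Gauss sum -q of a binary form come from one comparison: as
    eps is a nonsquare, the squares and the eps-multiples of squares together take each value
    exactly twice, so a sum over the anisotropic form is twice a full sum minus the sum over the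
    split form, where x^2 - z^2 factors. The Gauss sums of the symmetric X are summed over all
    invertible X of a given size by a second-order recursion in the size; the result alternates in
    sign with the parity of the size, which is the origin of eta. It also supplies the product of
    factors with odd exponent in A. B is the cofactor N/A: it keeps q + 1, the order of SO^-(2,q),
    and the remaining factors of the order of GL(n-1,q). Since a and -a have the same square,
    moments over F_q^* are twice those over the nonzero squares; the -1 in the exponent of 2
    accounts for this factor. *)

Lemma sum_param (T U : finType) (P : pred T) (Q : pred U) (h : T -> U) (f : U -> algC) :
  {in P &, injective h} -> (forall u, Q u = [exists p, P p && (u == h p)]) ->
  \sum_(u | Q u) f u = \sum_(p | P p) f (h p).
Proof.
move=> hinj QP; rewrite -(big_imset f hinj) /=; apply: eq_bigl => u.
rewrite QP; apply/existsP/imsetP => [[p /andP[Pp /eqP ->]]|[p Pp ->]]; exists p => //.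
by rewrite eqxx andbT.
Qed.

(** Translation by x0 multiplies the sum by [psi x0]. Stating it at one translation lets it serve
    the field, rectangular matrices and skew matrices alike. *)
Lemma char_sum0 (V : finZmodType) (S : pred V) (psi : V -> algC) (x0 : V) :
  (forall x, S (x0 + x) = S x) ->
  (forall x, psi (x0 + x) = psi x0 * psi x) ->
  psi x0 != 1 -> \sum_(x | S x) psi x = 0.
Proof.
move=> S0 psiD n1; set s := \sum_(x | _) _.
have: s = psi x0 * s.
  rewrite {1}/s (reindex_inj (addrI x0)) mulr_sumr.
  by apply: eq_big => x; [rewrite S0 | rewrite psiD].
move/eqP; rewrite -subr_eq0 -{1}[s]mul1r -mulrBl mulf_eq0 subr_eq0 eq_sym.
by rewrite (negPf n1) => /eqP.
Qed.

Lemma omega3_sum : 1 + omega3 + omega3 ^+ 2 = 0.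
Proof.
have i2 : ('i : algC) ^+ 2 = -1 by exact: sqrCi.
have s2 : (sqrtC 3%:R : algC) ^+ 2 = 3%:R by exact: sqrtCK.
rewrite /omega3; by field: i2 s2.
Qed.

Lemma omega3_cube : omega3 ^+ 3 = 1.
Proof.
have -> : omega3 ^+ 3 = 1 + (omega3 - 1) * (1 + omega3 + omega3 ^+ 2) by ring.
by rewrite omega3_sum mulr0 addr0.
Qed.

Lemma omega3_neq1 : omega3 != 1.
Proof.
apply/eqP => w1; have /eqP := omega3_sum.
by rewrite w1 expr1n -[1 + 1]/(2%:R) natr1 pnatr_eq0.
Qed.

Section Characters.
Variable F : finFieldType.
Hypothesis char3 : 3%N \in [pchar F].
Local Notation sdeg := (@sdeg F).

(** The additive group is an elementary abelian 3-group, so its order equals its 3-part, and [sdeg]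
    is the 3-adic valuation of that order. *)
Lemma card_pow3 : #|F| = (3 ^ sdeg)%N.
Proof.
have := abelem_pgroup (fin_ring_pchar_abelem char3).
rewrite /pgroup cardsT => /part_pnat_id.
by rewrite p_part => ->.
Qed.

Lemma three0 : 3%:R = 0 :> F.
Proof. exact: pcharf0. Qed.

Lemma two_N1 : 2%:R = -1 :> F.
Proof. by apply/eqP; rewrite -subr_eq0 opprK natr1 three0. Qed.

Lemma N1_neq1 : (-1 != 1 :> F).
Proof. by rewrite -two_N1 (natrD _ 1 1) -subr_eq0 addrK oner_eq0. Qed.

Lemma card_gt0 : (0 < #|F|)%N.
Proof. by rewrite card_pow3 expn_gt0. Qed.

Lemma abstrD (x y : F) : abstr (x + y) = abstr x + abstr y.
Proof.
rewrite /abstr -big_split; apply: eq_bigr => i _ /=.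
by rewrite exprDn_pchar // pnatX; apply/orP; left; rewrite pnatE.
Qed.

(** Cubing shifts the summands by one and the last returns to x, since x^q = x. Hence the trace is
    0, 1 or -1, and the last branch of [lambda] is the value -1 = 2. *)
Lemma abstr_cube (x : F) : abstr x ^+ 3 = abstr x.
Proof.
have p3 : [pchar F].-nat 3 by rewrite pnatE.
rewrite /abstr.
have -> : (\sum_(i < sdeg) x ^+ (3 ^ i)) ^+ 3 = \sum_(i < sdeg) x ^+ (3 ^ i.+1).
  rewrite (big_morph (fun y : F => y ^+ 3) (id1 := 0) (op1 := +%R)) //.
  - by apply: eq_bigr => i _; rewrite -exprM expnSr.
  - by move=> u v /=; rewrite exprDn_pchar.
  - by rewrite expr0n.
apply: (addIr x); rewrite addrC.
have <- : \sum_(i < sdeg.+1) x ^+ (3 ^ i) = x + \sum_(i < sdeg) x ^+ (3 ^ i.+1).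
  by rewrite big_ord_recl.
by rewrite big_ord_recr /= -card_pow3 expf_card.
Qed.

Lemma abstr_cases (x : F) : [|| abstr x == 0, abstr x == 1 | abstr x == -1].
Proof.
have /eqP := abstr_cube x; rewrite -subr_eq0 => /eqP H.
have: abstr x * ((abstr x - 1) * (abstr x + 1)) == 0.
  by apply/eqP; rewrite -[RHS]H; ring.
by rewrite !mulf_eq0 subr_eq0 addr_eq0.
Qed.

Lemma abstr0 : abstr (0 : F) = 0.
Proof. by have := abstrD 0 0; rewrite addr0 => /eqP; rewrite -subr_eq0 opprD addNKr oppr_eq0 => /eqP. Qed.

Lemma abstrN (x : F) : abstr (- x) = - abstr x.
Proof. by apply/eqP; rewrite -addr_eq0 -abstrD addNr abstr0. Qed.

Lemma lambda0 : lambda (0 : F) = 1.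
Proof. by rewrite /lambda abstr0 eqxx. Qed.

Lemma lambdaD (x y : F) : lambda (x + y) = lambda x * lambda y.
Proof.
rewrite /lambda abstrD.
have w3 := omega3_cube.
have n1 : (-1 == 1 :> F) = false by apply: negbTE N1_neq1.
have n1' : (-1 == 0 :> F) = false by rewrite oppr_eq0 oner_eq0.
have e : 1 + 1 = -1 :> F by rewrite -two_N1.
have e' : -1 - 1 = 1 :> F by rewrite -opprD e opprK.
case/or3P: (abstr_cases x) => /eqP ->; case/or3P: (abstr_cases y) => /eqP ->;
  rewrite ?add0r ?addr0 ?subrr ?addNr ?e ?e' ?n1 ?n1' ?eqxx ?oner_eq0 ?mul1r ?mulr1 //.
- by rewrite -exprSr w3.
by rewrite -exprD (exprD _ 3 1) w3 mul1r.
Qed.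

Lemma lambda_eq1 (x : F) : (lambda x == 1) = (abstr x == 0).
Proof.
rewrite /lambda; case: ifP => _; first by rewrite eqxx.
case: ifP => _; first by rewrite (negPf omega3_neq1).
apply/negbTE/eqP => w1; have := omega3_cube.
by rewrite exprS w1 mulr1 => w; have := omega3_neq1; rewrite w eqxx.
Qed.

Lemma lambda_sum_pm (x : F) :
  1 + lambda x + lambda (- x) = if abstr x == 0 then 3%:R else 0.
Proof.
have n1' : (-1 == 0 :> F) = false by rewrite oppr_eq0 oner_eq0.
rewrite /lambda abstrN; case/or3P: (abstr_cases x) => /eqP ->.
- by rewrite oppr0 eqxx -[1 + 1]/(2%:R) natr1.
- by rewrite n1' (negPf N1_neq1) eqxx oner_eq0 omega3_sum.
by rewrite opprK n1' (negPf N1_neq1) eqxx oner_eq0 addrAC omega3_sum.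
Qed.

(** Otherwise all 3^s elements would be roots of the trace polynomial, whose degree is at most
    3^(s-1) and whose coefficient of X is 1. *)
Lemma abstr_nontriv : exists x : F, abstr x != 0.
Proof.
apply/existsP; apply: contraT; rewrite negb_exists => /forallP H.
pose p : {poly F} := \sum_(i < sdeg) 'X^(3 ^ i).
have sdeg_gt0 : (0 < sdeg)%N.
  by have := finNzRing_gt1 F; rewrite card_pow3; case: sdeg.
have p0 : p != 0.
  apply/eqP => /(congr1 (fun p : {poly F} => p`_1)).
  rewrite /p coef_sum coef0 (bigD1 (Ordinal sdeg_gt0)) //= coefXn eqxx big1.
    by move/eqP; rewrite addr0 oner_eq0.
  move=> i i0; rewrite coefXn -(expn0 3) eqn_exp2l //.
  by rewrite eq_sym; move: i0; rewrite -val_eqE /= => /negPf ->.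
have sp : (size p <= (3 ^ sdeg.-1).+1)%N.
  apply: leq_trans (size_sum _ _ _) _; apply/bigmax_leqP => i _.
  by rewrite size_polyXn ltnS leq_exp2l // -ltnS prednK.
have := @max_poly_roots _ p (enum F) p0; rewrite enum_uniq -cardE => /(_ _ isT).
have -> : all (root p) (enum F).
  apply/allP => x _; rewrite /root /p horner_sum.
  have := H x; rewrite negbK => /eqP; rewrite /abstr => {2}<-.
  by apply/eqP/eq_bigr => i _; rewrite hornerXn.
move/(_ isT) => /leq_trans/(_ sp); rewrite ltnS card_pow3 leq_exp2l //.
by rewrite -{1}(prednK sdeg_gt0) ltnn.
Qed.

Lemma lambda_nontriv (c : F) : c != 0 -> exists x, lambda (c * x) != 1.
Proof.
move=> c0; have [x hx] := abstr_nontriv; exists (c^-1 * x).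
by rewrite mulVKf // lambda_eq1.
Qed.

Lemma lambda_sum (c : F) :
  \sum_x lambda (c * x) = if c == 0 then #|F|%:R else 0.
Proof.
case: eqP => [->|/eqP c0].
  under eq_bigr do rewrite mul0r lambda0.
  by rewrite sumr_const.
have [x hx] := lambda_nontriv c0.
apply: (@char_sum0 F predT (fun x => lambda (c * x)) x) => // y.
by rewrite mulrDr lambdaD.
Qed.

End Characters.

(** * Power moments of trace codes *)

Section Stirling.

(** The t-th forward difference of x^h at 0, that is t! S(h,t). *)
Definition fdiff (h t : nat) : algC :=
  \sum_(j < t.+1) (-1) ^+ (t - j) * ('C(t, j))%:R * (j%:R) ^+ h.

Lemma fdiff_stirling h t : t`!%:R * stirling2 h t = fdiff h t.
Proof. by rewrite /stirling2 mulVKf // pnatr_eq0 -lt0n fact_gt0. Qed.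

Lemma fdiff0 t : fdiff 0 t = (t == 0%N)%:R.
Proof.
transitivity ((-1 + 1 : algC) ^+ t); last by rewrite addNr expr0n.
rewrite exprDn; apply: eq_bigr => j _.
by rewrite expr0 mulr1 expr1n mulr1 mulr_natr.
Qed.

(** This is S(h+1,t) = t S(h,t) + S(h,t-1) multiplied by t!. *)
Lemma fdiff_rec h t : fdiff h.+1 t = t%:R * (fdiff h t + (if t is t'.+1 then fdiff h t' else 0)).
Proof.
case: t => [|t].
  by rewrite mul0r /fdiff big_ord_recl big_ord0 expr0n /= mulr0 addr0.
have -> : fdiff h t = - \sum_(j < t.+2) (-1) ^+ (t.+1 - j) * ('C(t, j))%:R * (j%:R) ^+ h.
  rewrite big_ord_recr /= bin_small // mulr0 mul0r addr0 -sumrN.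
  apply: eq_bigr => j _; rewrite subSn; last by rewrite -ltnS.
  by rewrite exprS mulN1r !mulNr opprK.
rewrite /fdiff -sumrB mulr_sumr; apply: eq_bigr => j _.
have e : j%:R * ('C(t.+1, j))%:R = t.+1%:R * (('C(t.+1, j))%:R - ('C(t, j))%:R) :> algC.
  case: (j : nat) => [|i]; first by rewrite !bin0 subrr mul0r mulr0.
  rewrite -natrM -(mul_bin_diag t.+1 i) natrM binS natrD /=.
  by congr (_ * _); rewrite addrAC subrr add0r.
transitivity ((-1) ^+ (t.+1 - j) * (j%:R * ('C(t.+1, j))%:R) * j%:R ^+ h : algC).
  by rewrite exprS; ring.
by rewrite e; ring.
Qed.

Lemma fdiff_big h t : (h < t)%N -> fdiff h t = 0.
Proof.
elim: h t => [|h IH] t ht; first by rewrite fdiff0; case: t ht.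
by rewrite fdiff_rec; case: t ht => // t ht; rewrite !IH ?addr0 ?mulr0 // ltnW.
Qed.

(** Newton's forward-difference expansion, which turns power moments of the weights into binomial
    moments. The inductive step is w C(w,t) = t C(w,t) + (t+1) C(w,t+1). *)
Lemma newton_power h w : w%:R ^+ h = \sum_(t < h.+1) fdiff h t * ('C(w, t))%:R.
Proof.
elim: h => [|h IH]; first by rewrite big_ord_recl big_ord0 fdiff0 bin0 expr0 addr0 mulr1.
rewrite exprS IH mulr_sumr.
have step t : w%:R * (fdiff h t * ('C(w, t))%:R) =
    t%:R * fdiff h t * ('C(w, t))%:R + t.+1%:R * fdiff h t * ('C(w, t.+1))%:R.
  have e : w%:R * ('C(w, t))%:R = t%:R * ('C(w, t))%:R + t.+1%:R * ('C(w, t.+1))%:R :> algC.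
    rewrite -!natrM -natrD; congr (_%:R); rewrite mul_bin_left.
    have [tw|wt] := leqP t w; first by rewrite -mulnDl subnKC.
    by rewrite bin_small // !muln0.
  by rewrite mulrCA e; ring.
under eq_bigr do rewrite step.
under [RHS]eq_bigr do rewrite fdiff_rec mulrDr mulrDl.
rewrite !big_split /=; congr (_ + _).
  by rewrite [RHS]big_ord_recr /= fdiff_big // mulr0 mul0r addr0.
by rewrite [RHS]big_ord_recl /= !mul0r add0r.
Qed.
End Stirling.

Section PowerMoments.
Variable F : finFieldType.
Hypothesis char3 : 3%N \in [pchar F].
Local Notation q := (#|F|%:R : algC).
Variables (I : finType) (D : {set I}) (x : I -> F).
Local Notation N := #|D|.

Definition trace_weight (a : F) : nat := #|[set g in D | abstr (a * x g) != 0]|.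
Definition code : {set {ffun I -> 'F_3}} :=
  [set u : {ffun I -> 'F_3} |
      [forall g, (g \notin D) ==> (u g == 0)] &&
      (\sum_(g in D) F3toF (u g) * x g == 0 :> F)].
Definition code_weight (j : nat) : nat := #|[set u in code | #|[set g | u g != 0]| == j]|.

Local Notation third := (3%:R^-1 : algC).
(* With these weights for u = 0 and u <> 0 the character sum over F_3 is 1 + X or 1,
   according to whether the coordinate is nonzero. *)
Definition enum0 : {poly algC} := 1 + (2%:R * third) *: 'X.
Definition enum1 : {poly algC} := (- third) *: 'X.

(** lambda(y) + lambda(-y) is 2 if the trace of y vanishes and -1 otherwise, so the coefficient of X
    is 2/3 - 2/3 or 2/3 + 1/3. *)
Lemma weight_factor (y : F) :
  (if abstr y != 0 then 1 + 'X else 1) =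
  \sum_(u : 'F_3) (if u == 0 then enum0 else enum1) * (lambda (F3toF u * y))%:P.
Proof.
have three : (3%:R : algC) != 0 by rewrite pnatr_eq0.
rewrite (big_ord_recl 2) /= (big_ord_recl 1) (big_ord_recl 0) big_ord0 /= addr0.
rewrite /F3toF /= mul0r lambda0 // mul1r (two_N1 char3) mulN1r mulr1.
have e := lambda_sum_pm char3 y.
rewrite -mulrDr -polyCD /enum0 /enum1.
have -> : lambda y + lambda (- y) = (if abstr y == 0 then 3%:R else 0) - 1.
  by rewrite -e; ring.
case: (abstr y == 0) => /=; rewrite -!mul_polyC.
  rewrite -!addrA -[LHS]addr0; congr (_ + _).
  rewrite mulrAC -mulrDl -polyCM -polyCD.
  rewrite (_ : _ + _ = 0) ?mul0r //.
  by field.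
rewrite -addrA; congr (_ + _); rewrite mulrAC -mulrDl -polyCM -polyCD.
by rewrite (_ : _ + _ = 1) ?mul1r //; field.
Qed.

Lemma weight_product (a : F) :
  (1 + 'X : {poly algC}) ^+ trace_weight a = \prod_(g in D) (if abstr (a * x g) != 0 then 1 + 'X else 1).
Proof.
rewrite -big_mkcondr -prodr_const; apply: eq_bigl => g.
by rewrite inE.
Qed.

Definition supp_in_D : pred {ffun I -> 'F_3} := fun u => [forall g, (g \notin D) ==> (u g == 0)].
Definition code_supp (u : {ffun I -> 'F_3}) : {set I} := [set g | u g != 0].

Lemma enum_product (u : {ffun I -> 'F_3}) : supp_in_D u ->
  \prod_(g in D) (if u g == 0 then enum0 else enum1) =
  enum0 ^+ (N - #|code_supp u|) * enum1 ^+ #|code_supp u|.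
Proof.
move/forallP=> uD.
have sD : code_supp u \subset D.
  by apply/subsetP => g; rewrite inE; apply: contraNT => gD; have := uD g; rewrite gD.
rewrite (big_setID (code_supp u)) /= mulrC; congr (_ * _).
  rewrite -(cardsDS sD) -prodr_const; apply: eq_bigr => g.
  by rewrite !inE negbK => /andP[->].
rewrite (setIidPr sD) -prodr_const; apply: eq_bigr => g.
by rewrite inE => /negPf ->.
Qed.

(* The sum runs over a in F_q and not over the dual code, so that no injectivity of
   a |-> (tr (a x_g))_g is needed. *)
Lemma weight_enumerator :
  \sum_a (1 + 'X : {poly algC}) ^+ trace_weight a =
  q%:P * \sum_(u in code) enum0 ^+ (N - #|code_supp u|) * enum1 ^+ #|code_supp u|.
Proof.
pose s (u : {ffun I -> 'F_3}) : F := \sum_(g in D) F3toF (u g) * x g.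
transitivity (\sum_(a : F) \sum_(u | supp_in_D u)
   (enum0 ^+ (N - #|code_supp u|) * enum1 ^+ #|code_supp u|) * (lambda (s u * a))%:P).
  apply: eq_bigr => a _; rewrite weight_product.
  under eq_bigr do rewrite weight_factor.
  (* The product over D of sums over F_3 expands into a sum over vectors u; the default value 0
     selects those supported in D. *)
  rewrite (big_distr_big_dep 0); apply: eq_big => [u|u uD].
    apply/pfamilyP/forallP => [[/subsetP uD _] g|uD].
      by apply/implyP; apply: contraNT => ug; apply: uD; rewrite inE.
    split=> //; apply/subsetP => g; rewrite inE; apply: contraNT => gD.
    by have := uD g; rewrite gD.
  have {}uD : supp_in_D u.
    move/pfamilyP: uD => [/subsetP uD _]; apply/forallP => g.
    by apply/implyP; apply: contraNT => ug; apply: uD; rewrite inE.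
  rewrite big_split /= enum_product //; congr (_ * _).
  rewrite -rmorph_prod; congr (_%:P); rewrite /s mulr_suml.
  rewrite (big_morph _ (lambdaD char3) (lambda0 char3)); apply: eq_bigr => g _.
  by rewrite mulrAC mulrA.
(* Orthogonality in a: the inner sum is q on codewords and 0 elsewhere. *)
rewrite exchange_big mulr_sumr [RHS](eq_bigl (fun u => supp_in_D u && (s u == 0))); last first.
  by move=> u; rewrite inE.
rewrite big_mkcondr; apply: eq_bigr => u _.
rewrite -mulr_sumr -rmorph_sum lambda_sum //; case: (s u == 0); last by rewrite mulr0.
by rewrite mulrC.
Qed.

Lemma coef_lin_pow (c : algC) (n t : nat) :
  ((1 + c *: 'X) ^+ n)`_t = c ^+ t * ('C(n, t))%:R.
Proof.
elim: n t => [|n IH] t; first by rewrite expr0 coef1 bin0n; case: t => [|t]; rewrite ?mulr1 ?mulr0.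
rewrite exprS mulrDl mul1r -scalerAl coefD coefZ coefXM IH.
case: t => [|t]; first by rewrite /= mulr0 addr0 !bin0.
by rewrite /= IH binS natrD exprS; ring.
Qed.

(** The contribution of a codeword of weight j to the coefficient of X^t. The guard covers t < j,
    where the factor X^j kills the coefficient but t - j truncates to 0. *)
Definition enum_coef (j t : nat) : algC :=
  if (j <= t)%N then (-1) ^+ j * 2%:R ^+ (t - j) * 3%:R ^- t * ('C(N - j, t - j))%:R else 0.

Lemma enum_coefE j t : (enum0 ^+ (N - j) * enum1 ^+ j)`_t = enum_coef j t.
Proof.
rewrite /enum1 exprZn -scalerAr coefZ coefMXn /enum_coef ltnNge.
case: leqP => // jt /=; last by rewrite mulr0.
rewrite coef_lin_pow (exprNn third) exprMn.
have -> : (3%:R : algC) ^- t = third ^+ j * third ^+ (t - j) by rewrite -exprD subnKC // exprVn.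

by ring.
Qed.

Lemma binomial_moment t :
  \sum_a ('C(trace_weight a, t))%:R = q * \sum_(j < N.+1) (code_weight j)%:R * enum_coef j t.
Proof.
have := congr1 (fun p : {poly algC} => p`_t) weight_enumerator.
rewrite coef_sum coefCM coef_sum.
under eq_bigr do rewrite -['X]scale1r coef_lin_pow expr1n mul1r.
move=> ->; congr (_ * _).
have le u : u \in code -> (#|code_supp u| < N.+1)%N.
  rewrite inE => /andP[/forallP uD _]; rewrite ltnS subset_leq_card //.
  by apply/subsetP => g; rewrite inE; apply: contraNT => gD; have := uD g; rewrite gD.
rewrite (partition_big (fun u => inord #|code_supp u| : 'I_N.+1) predT) //=.
apply: eq_bigr => j _.
have -> : (code_weight j)%:R = \sum_(u | (u \in code) && (#|code_supp u| == j)) 1 :> algC.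
  rewrite /code_weight -[in LHS]sum1_card natr_sum; apply: eq_bigl => u.
  by rewrite inE.
rewrite mulr_suml; apply: eq_big => [u|u /andP[uC /eqP <-]].
  case: (boolP (u \in code)) => //= uC.
  by rewrite -val_eqE /= inordK // le.
by rewrite enum_coefE mul1r inordK // le.
Qed.

Lemma power_moment h :
  \sum_a (trace_weight a)%:R ^+ h =
  q * 2%:R * (2%:R / 3%:R) ^+ h *
    \sum_(j < (minn N h).+1)
          (-1) ^+ j * (code_weight j)%:R *
          \sum_(j <= t < h.+1)
            t`!%:R * stirling2 h t * 3%:R ^+ (h - t) *
            (2%:R : algC) ^ (t%:Z - h%:Z - j%:Z - 1) *
            (if (t <= N)%N then ('C(N - j, N - t))%:R else 0).
Proof.
have two0 : (2%:R : algC) != 0 by rewrite pnatr_eq0.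
have three0 : (3%:R : algC) != 0 by rewrite pnatr_eq0.
pose G (j : nat) : algC := (code_weight j)%:R * \sum_(t < h.+1) fdiff h t * enum_coef j t.
transitivity (q * \sum_(j < N.+1) G j).
  under eq_bigr do rewrite newton_power.
  rewrite exchange_big /=.
  under eq_bigr do rewrite -mulr_sumr binomial_moment mulrCA.
  rewrite -mulr_sumr; congr (_ * _).
  under [LHS]eq_bigr do rewrite mulr_sumr.
  rewrite exchange_big; apply: eq_bigr => j _; rewrite /G mulr_sumr.
  by apply: eq_bigr => t _; rewrite mulrCA.
rewrite -!mulrA; congr (_ * _); rewrite mulrA mulr_sumr.
rewrite [RHS](big_ord_widen N.+1 (fun j => 2%:R * (2%:R / 3%:R) ^+ h * ((-1) ^+ j * (code_weight j)%:R *
          \sum_(j <= t < h.+1)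
            t`!%:R * stirling2 h t * 3%:R ^+ (h - t) *
            (2%:R : algC) ^ (t%:Z - h%:Z - j%:Z - 1) *
            (if (t <= N)%N then ('C(N - j, N - t))%:R else 0)))) ?ltnS ?geq_minl //.
rewrite [RHS]big_mkcond; apply: eq_bigr => [[j jN]] _ /=; rewrite ltnS in jN.
rewrite ltnS leq_min jN /= /G.
(* If j > h, every t <= h lies below j and [enum_coef] vanishes; this cuts the sum at min(N,h). *)
case: leqP => jh; last first.
  rewrite big1 ?mulr0 // => t _.
  by rewrite /enum_coef leqNgt (leq_trans (ltn_ord t) jh) mulr0.
rewrite big_geq_mkord !mulr_sumr [RHS]big_mkcond /=; apply: eq_bigr => [[t th]] _ /=.
rewrite /enum_coef; case: ifP => jt; last by rewrite !mulr0.
rewrite fdiff_stirling.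
(* For t <= N this is the symmetry of binomials. For t > N the guard supplies 0, where the truncated
   N - t would give C(N-j,0) = 1. *)
have -> : (if (t <= N)%N then ('C(N - j, N - t))%:R else 0) = ('C(N - j, t - j))%:R :> algC.
  case: leqP => tN; last by rewrite bin_small //; lia.
  rewrite -(bin_sub (n := N - j)); last by lia.
  by congr (('C(_, _))%:R); lia.
(* The negative exponent splits into 2^(t-j) and 2^-(h+1); the latter cancels the powers of 2 in the
   extracted factor 2 (2/3)^h. *)
have -> : t%:Z - h%:Z - j%:Z - 1 = (t - j)%N%:Z - h.+1%:Z by lia.
rewrite expfzDr // -exprnP -exprnN exprSr expr_div_n.
have -> : (3%:R : algC) ^+ h = 3%:R ^+ (h - t) * 3%:R ^+ t by rewrite -exprD subnK.
have n2 : (2%:R : algC) ^+ h != 0 by rewrite expf_neq0.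
have n3 : (3%:R : algC) ^+ t != 0 by rewrite expf_neq0.
have n3' : (3%:R : algC) ^+ (h - t) != 0 by rewrite expf_neq0.
move: (2%:R ^+ h) (3%:R ^+ t) (3%:R ^+ (h - t)) (2%:R ^+ (t - j)) (fdiff h t) n2 n3 n3' => a b c d f a0 b0 c0.
by field; rewrite a0 b0 c0.
Qed.
End PowerMoments.

(** * The norm form and SO^-(2,q) *)

Section NormForm.
Variables (F : finFieldType) (eps : F).
Hypotheses (char3 : 3%N \in [pchar F]) (eps0 : eps != 0) (epsN : ~~ is_square eps).

(* [ring] does not know that 3 = 0; this lets it work over the integers. *)
Lemma eq_mod3 (c a b : F) : a = b + 3%:R * c -> a = b.
Proof. by rewrite three0 // mul0r addr0. Qed.

Lemma card_sqrt_le2 (D : F) : (#|[set z : F | z ^+ 2 == D]| <= 2)%N.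
Proof.
case: (set_0Vmem [set z : F | z ^+ 2 == D]) => [->|[z0]]; first by rewrite cards0.
rewrite inE => /eqP <-.
apply: (@leq_trans #|[set z0; - z0]|); last by rewrite cards2; case: eqP.
by apply/subset_leq_card/subsetP => z; rewrite !inE eqf_sqr.
Qed.

(* Each of the two terms sums to q over D and their sum is at most 2 everywhere, so it is always 2. *)
Lemma card_sqrt_twisted (D : F) :
  (#|[set z : F | (z ^+ 2 == D)%R]| + #|[set y : F | (eps * y ^+ 2 == D)%R]| = 2)%N.
Proof.
set a := fun D : F => #|[set z : F | z ^+ 2 == D]|.
set b := fun D : F => #|[set y : F | eps * y ^+ 2 == D]|.
have cnt (f : F -> F) : (\sum_D #|[set z : F | f z == D]| = #|F|)%N.
  rewrite -[RHS](sum1_card F) [RHS](partition_big f predT) //=.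
  by apply: eq_bigr => d _; rewrite -sum1_card; apply: eq_bigl => z; rewrite inE.
have ab D' : (a D' + b D' <= 2)%N.
  have [->|D0] := eqVneq D' 0.
    rewrite /a /b (_ : [set z | _] = [set 0]); last first.
      by apply/setP => z; rewrite !inE expf_eq0.
    rewrite cards1 (_ : [set y | _] = [set 0]) ?cards1 //.
    by apply/setP => z; rewrite !inE mulf_eq0 (negPf eps0) expf_eq0.
  (* For D' nonzero the two sets cannot both be inhabited: z^2 = eps y^2 would make eps the square
     of z / y. *)
  case: (set_0Vmem [set y : F | eps * y ^+ 2 == D']) => [|[y]].
    by rewrite /b => ->; rewrite cards0 addn0 card_sqrt_le2.
  rewrite inE => /eqP ey.
  have -> : a D' = 0%N.
    apply/eqP; rewrite cards_eq0; apply/eqP/setP => z; rewrite !inE.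
    apply/negP => /eqP zD; case/negP: epsN; apply/existsP; exists (z / y).
    have y0 : y != 0 by apply: contraNneq D0 => y0; rewrite -ey y0 expr0n mulr0.
    by rewrite expr_div_n zD -ey mulfK ?expf_neq0.
  rewrite add0n /b (_ : [set y | _] = [set z : F | z ^+ 2 == D' / eps]).
    exact: card_sqrt_le2.
  by apply/setP => z; rewrite !inE mulrC -(can2_eq (mulfK eps0) (mulfVK eps0)).
have tot : (\sum_D (2 - (a D + b D)) = 0)%N.
  apply/eqP; rewrite -(eqn_add2r (\sum_D (a D + b D))) -big_split /=.
  under eq_bigr do rewrite subnK //.
  by rewrite sum_nat_const big_split /= /a /b (cnt (fun z => z ^+ 2)) (cnt (fun y => eps * y ^+ 2)) muln2 addnn.
move/eqP: tot; rewrite sum_nat_eq0 => /forallP/(_ D)/=.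
by rewrite subn_eq0 => H; apply/eqP; rewrite eqn_leq ab.
Qed.

Lemma sum_sqr_twisted (f : F -> algC) :
  \sum_z f (z ^+ 2) + \sum_y f (eps * y ^+ 2) = 2%:R * \sum_D f D.
Proof.
have cnt (g : F -> F) : \sum_z f (g z) = \sum_D #|[set z : F | g z == D]|%:R * f D.
  rewrite (partition_big g predT) //=; apply: eq_bigr => d _.
  rewrite -sum1_card natr_sum mulr_suml.
  by apply: eq_big => [z|z /eqP ->]; rewrite ?inE ?mul1r.
rewrite (cnt (fun z => z ^+ 2)) (cnt (fun y => eps * y ^+ 2)) -big_split mulr_sumr.
by apply: eq_bigr => d _ /=; rewrite -mulrDl -natrD card_sqrt_twisted.
Qed.

(** The complete sum over D vanishes, so replacing eps y^2 by z^2 flips the sign of the inner sum.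
    With x = u + z the split form becomes linear in z, and only u = 0 survives. *)
Lemma norm_form_gauss (c : F) : c != 0 ->
  \sum_x \sum_y lambda (c * (x ^+ 2 - eps * y ^+ 2)) = - #|F|%:R.
Proof.
move=> c0.
have tw : \sum_y lambda (- c * (eps * y ^+ 2)) = - \sum_z lambda (- c * z ^+ 2).
  apply/eqP; rewrite -addr_eq0 addrC (sum_sqr_twisted (fun D => lambda (- c * D))).
  by rewrite lambda_sum // oppr_eq0 (negPf c0) mulr0.
have -> : \sum_x \sum_y lambda (c * (x ^+ 2 - eps * y ^+ 2))
   = - \sum_x \sum_z lambda (c * (x ^+ 2 - z ^+ 2)).
  rewrite -sumrN; apply: eq_bigr => x _.
  transitivity (lambda (c * x ^+ 2) * \sum_y lambda (- c * (eps * y ^+ 2))).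
    by rewrite mulr_sumr; apply: eq_bigr => y _; rewrite -lambdaD // mulNr mulrBr.
  rewrite tw mulrN mulr_sumr; congr (- _); apply: eq_bigr => z _.
  by rewrite -lambdaD // mulNr mulrBr.
congr (- _); rewrite exchange_big /=.
transitivity (\sum_z \sum_u lambda (c * u ^+ 2) * lambda (- (c * u) * z)).
  apply: eq_bigr => z _; rewrite (reindex_inj (addIr z)) /=.
  apply: eq_bigr => u _; rewrite -lambdaD //; congr lambda.
  by rewrite mulNr -mulrA -mulrN -mulrDr; congr (_ * _); apply: (@eq_mod3 (u * z)); ring.
rewrite exchange_big (bigD1 0) //= [X in _ + X]big1 ?addr0.
  under eq_bigr do rewrite expr0n mulr0 oppr0 mul0r lambda0 // mulr1.
  by rewrite sumr_const.
move=> u u0; rewrite -mulr_sumr lambda_sum // oppr_eq0 mulf_eq0 (negPf c0) (negPf u0).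
by rewrite mulr0.
Qed.

(* On the split conic x^2 - z^2 = 1 the parameter is t = x - z, so that 2 x = t + t^-1
   and x = -(t + t^-1). *)
Lemma sum_norm1 (f : F -> algC) :
  \sum_(p : F * F | p.1 ^+ 2 - eps * p.2 ^+ 2 == 1) f p.1 =
  2%:R * (\sum_x f x) - \sum_(t : F | t != 0) f (- (t + t^-1)).
Proof.
have split_hyp : \sum_(t : F | t != 0) f (- (t + t^-1)) =
    \sum_(p : F * F | p.1 ^+ 2 - p.2 ^+ 2 == 1) f p.1.
  rewrite (reindex_onto (fun t : F => (- (t + t^-1), t - t^-1)) (fun p => p.1 - p.2)).
    apply: eq_bigl => t /=.
    have e : - (t + t^-1) - (t - t^-1) = t by apply: (@eq_mod3 (- t)); ring.
    rewrite e eqxx andbT; have [->|t0] := eqVneq t 0.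
      by rewrite invr0 addr0 subr0 oppr0 subrr eq_sym oner_eq0.
    apply/esym/eqP; have -> : (- (t + t^-1)) ^+ 2 - (t - t^-1) ^+ 2 = 1 + 3%:R * (t / t).
      by rewrite divff //; field.
    by rewrite three0 // mul0r addr0.
  move=> [x z] /= /eqP; rewrite subr_sqr => e.
  have n0 : x - z != 0 by apply: contraPneq e => ->; rewrite mul0r => /eqP; rewrite eq_sym oner_eq0.
  have -> : (x - z)^-1 = x + z by rewrite -[LHS]mulr1 -e mulKf.
  by congr (_, _); [apply: (@eq_mod3 (- x)) | apply: (@eq_mod3 (- z))]; ring.
rewrite split_hyp.
have rows (g : F -> F) : \sum_(p : F * F | p.1 ^+ 2 - g p.2 == 1) f p.1 =
    \sum_x #|[set z | g z == x ^+ 2 - 1]|%:R * f x.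
  rewrite -(pair_big_dep predT (fun x z : F => x ^+ 2 - g z == 1) (fun x _ => f x)) /=.
  apply: eq_bigr => x _; rewrite -sum1_card natr_sum mulr_suml.
  apply: eq_big => [z|z _]; last by rewrite mul1r.
  by rewrite inE subr_eq addrC -subr_eq eq_sym.
rewrite (rows (fun y => eps * y ^+ 2)) (rows (fun y => y ^+ 2)).
apply/eqP; rewrite -subr_eq0 opprB addrA subr_eq0 -big_split mulr_sumr; apply/eqP.
by apply: eq_bigr => x _ /=; rewrite -mulrDl -natrD addnC card_sqrt_twisted.
Qed.

(** Multiplication by p.1 + p.2 sqrt(eps) on the quadratic extension, in the basis 1, sqrt(eps); its
    determinant is the norm. *)
Definition so2 (p : F * F) : 'M[F]_2 :=
  \matrix_(i, j) if i == j then p.1 else if i == 0 then eps * p.2 else p.2.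

Lemma in_SO2P (i : 'M[F]_2) :
  in_SO2minus eps i = [exists p, (p.1 ^+ 2 - eps * p.2 ^+ 2 == 1) && (i == so2 p)].
Proof.
have ent (M N : 'M[F]_2) : M = N <->
    [/\ M 0 0 = N 0 0, M 0 1 = N 0 1, M 1 0 = N 1 0 & M 1 1 = N 1 1].
  split=> [->//|[h1 h2 h3 h4]]; apply/matrixP => u v.
  have o2 (w : 'I_2) : w = 0 \/ w = 1 by case: w => [[|[|//]] hw]; [left|right]; apply: val_inj.
  by case: (o2 u) => ->; case: (o2 v) => ->.
have lift01 : lift ord0 (ord0 : 'I_1) = 1 :> 'I_2 by apply: val_inj.
have lift10 : lift 1 (ord0 : 'I_1) = 0 :> 'I_2 by apply: val_inj.
have det2 (M : 'M[F]_2) : \det M = M 0 0 * M 1 1 - M 0 1 * M 1 0.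
  rewrite (expand_det_row _ 0) !big_ord_recl big_ord0 /cofactor !det_mx11 !mxE /= lift01 lift10.
  rewrite (_ : ord0 = 0) // /bump /= expr0 expr1; ring.
have in1 : (1 == 0 :> 'I_2) = false by [].
have dm (M : 'M[F]_2) : [/\ (M^T *m delta eps *m M) 0 0 = M 0 0 ^+ 2 - eps * M 1 0 ^+ 2,
    (M^T *m delta eps *m M) 0 1 = M 0 0 * M 0 1 - eps * (M 1 0 * M 1 1),
    (M^T *m delta eps *m M) 1 0 = M 0 1 * M 0 0 - eps * (M 1 1 * M 1 0)
    & (M^T *m delta eps *m M) 1 1 = M 0 1 ^+ 2 - eps * M 1 1 ^+ 2].
  by split; rewrite !mxE !big_ord_recl !big_ord0 !mxE !big_ord_recl !big_ord0 !mxE /= ?lift01; ring.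
apply/idP/existsP => [/and3P[_ /eqP /ent []]|[p /andP[/eqP p1 /eqP ->]]].
  case: (dm i) => -> -> -> ->; rewrite !mxE /= => h1 h2 h3 h4.
  rewrite det2 => /eqP h5.
  (* Both sides are multiplied by 1, written as the norm of the first column on the left and as the
     determinant on the right; orthogonality of the columns does the rest. *)
  have t : i 1 1 = i 0 0.
    rewrite -[LHS]mulr1 -h1 mulrBr -[RHS]mulr1 -[in RHS]h5.
    have {}h2 : i 0 0 * i 0 1 = eps * (i 1 0 * i 1 1) by apply/eqP; rewrite -subr_eq0 h2.
    have -> : i 1 1 * (eps * i 1 0 ^+ 2) = i 1 0 * (eps * (i 1 0 * i 1 1)) by ring.
    by rewrite -h2; ring.
  have r : i 0 1 = eps * i 1 0.
    rewrite -[LHS]mulr1 -h1 mulrBr -[RHS]mulr1 -[in RHS]h5.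
    have {}h2 : i 0 0 * i 0 1 = eps * (i 1 0 * i 1 1) by apply/eqP; rewrite -subr_eq0 h2.
    have -> : i 0 1 * i 0 0 ^+ 2 = i 0 0 * (i 0 0 * i 0 1) by ring.
    by rewrite h2; ring.
  exists (i 0 0, i 1 0); rewrite /= h1 eqxx; apply/eqP/ent.
  by rewrite !mxE.
have dd : \det (so2 p) = 1 by rewrite det2 !mxE /= -p1; ring.
rewrite /in_SO2minus unitmxE dd unitr1 eqxx andbT; apply/eqP/ent.
by case: (dm (so2 p)) => -> -> -> ->; rewrite !mxE /=; split=> //; [ring | ring | rewrite -[RHS]mulr1 -p1; ring].
Qed.
Lemma so2_inj : injective so2.
Proof.
move=> [x y] [x' y'] /matrixP h.
by have := h 0 0; have := h 1 0; rewrite !mxE /= => -> ->.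
Qed.

Lemma so2_tr p : \tr (so2 p) = - p.1.
Proof.
rewrite /mxtrace !big_ord_recl big_ord0 !mxE /=.
by apply: (@eq_mod3 p.1); ring.
Qed.

(** The nonsplit torus complements the split torus of pairs t, t^-1: each trace occurs exactly twice
    in all, either in one torus or once in both. *)
Lemma sum_SO2 (f : F -> algC) :
  \sum_(i | in_SO2minus eps i) f (\tr i) =
  2%:R * (\sum_x f x) - \sum_(t : F | t != 0) f (t + t^-1).
Proof.
transitivity (\sum_(p : F * F | p.1 ^+ 2 - eps * p.2 ^+ 2 == 1) f (- p.1)).
  rewrite (sum_param (P := fun p => p.1 ^+ 2 - eps * p.2 ^+ 2 == 1) (h := so2)).
  - by apply: eq_bigr => p _; rewrite so2_tr.
  - by move=> p p' _ _; apply: so2_inj.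
  - exact: in_SO2P.
rewrite (sum_norm1 (fun x => f (- x))); congr (2%:R * _ - _).
  by rewrite [RHS](reindex_inj oppr_inj).
by apply: eq_bigr => t _; rewrite opprK.
Qed.

Lemma card_SO2 : #|[set i | in_SO2minus eps i]| = #|F|.+1.
Proof.
rewrite cardsE; apply/eqP; rewrite -(eqr_nat algC); apply/eqP.
have := sum_SO2 (fun _ => 1); rewrite !sumr_const => ->.
rewrite (cardC1 (0 : F)) -[RHS]natr1 -(prednK (card_gt0 char3)) -natr1 /=.
by ring.
Qed.

(** The substitution alpha = a t turns alpha + a^2 / alpha into a (t + 1/t), which is why K is only
    met at squares. *)
Lemma Kloos_sqr (a : F) : a != 0 ->
  Kloos (a ^+ 2) = \sum_(t : F | t != 0) lambda (a * (t + t^-1)).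
Proof.
move=> a0; rewrite /Kloos [LHS](reindex_inj (mulfI a0)) /=.
apply: eq_big => t; first by rewrite mulf_eq0 (negPf a0).
by move=> t0; rewrite mulrDr expr2 -mulf_div divff // mul1r.
Qed.

Lemma sum_SO2_lambda (a : F) : a != 0 ->
  \sum_(i | in_SO2minus eps i) lambda (a * \tr i) = - Kloos (a ^+ 2).
Proof.
move=> a0; rewrite (sum_SO2 (fun x => lambda (a * x))) lambda_sum // (negPf a0) mulr0 sub0r.
by rewrite Kloos_sqr.
Qed.

End NormForm.

(** * Gauss sums of symmetric matrices *)

Section SymmetricGauss.
Variables (F : finFieldType) (eps : F).
Hypotheses (char3 : 3%N \in [pchar F]) (eps0 : eps != 0) (epsN : ~~ is_square eps).
Local Notation q := (#|F|%:R : algC).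
Local Notation dlt := (delta eps).

Lemma tr_delta : dlt^T = dlt.
Proof.
apply/matrixP => i j; rewrite !mxE eq_sym; case: eqP => // ->.
by [].
Qed.

Lemma delta_unit : dlt \in unitmx.
Proof.
have -> : dlt = diag_mx (\row_(j < 2) (if (j : nat) == 0%N then 1 else - eps)).
  by apply/matrixP => i j; rewrite !mxE eq_sym; case: eqP => // ->.
rewrite unitmxE det_diag unitfE; apply/prodf_neq0 => i _.
by rewrite mxE; case: ifP; rewrite ?oner_eq0 ?oppr_eq0.
Qed.

Lemma sum_mx11 (f : 'M[F]_1 -> algC) : \sum_d f d = \sum_x f x%:M.
Proof.
rewrite (sum_param (P := predT) (h := fun x : F => x%:M)) //.
  by move=> x y _ _ /matrixP/(_ 0 0); rewrite !mxE.
by move=> u; apply/esym/existsP; exists (u 0 0); rewrite -mx11_scalar eqxx.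
Qed.

Lemma sum_row_mx (m a b : nat) (f : 'M[F]_(m, a + b) -> algC) :
  \sum_h f h = \sum_h1 \sum_h2 f (row_mx h1 h2).
Proof.
rewrite pair_bigA /= (sum_param (P := predT) (h := fun p => row_mx p.1 p.2)) //.
  by move=> [x y] [x' y'] _ _ /= /eq_row_mx [-> ->].
by move=> u; apply/esym/existsP; exists (lsubmx u, rsubmx u); rewrite hsubmxK eqxx.
Qed.

Lemma sum_block_mx (r : nat) (f : 'M[F]_(r + 1) -> algC) :
  \sum_A f A = \sum_X \sum_u \sum_v \sum_d f (block_mx X u v d%:M).
Proof.
under [RHS]eq_bigr => X _ do under eq_bigr => u _ do under eq_bigr => v _ do
  rewrite -(sum_mx11 (fun d => f (block_mx X u v d))).
rewrite pair_bigA /=; under [RHS]eq_bigr => p _ do rewrite pair_bigA /=.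
rewrite pair_bigA /=.
rewrite (sum_param (P := predT) (h := fun p => block_mx p.1.1 p.1.2 p.2.1 p.2.2)) //.
  by move=> [[a b] [c d]] [[a' b'] [c' d']] _ _ /= /eq_block_mx [-> -> -> ->].
move=> u; apply/esym/existsP.
by exists ((ulsubmx u, ursubmx u), (dlsubmx u, drsubmx u)); rewrite /= submxK eqxx.
Qed.

Lemma sum_sym_block (r : nat) (f : 'M[F]_(r + 1) -> algC) :
  \sum_(A | A^T == A) f A =
  \sum_(X | X^T == X) \sum_v \sum_d f (block_mx X v v^T d%:M).
Proof.
rewrite big_mkcond sum_block_mx [RHS]big_mkcond; apply: eq_bigr => X _.
have E u v (d : F) : ((block_mx X u v d%:M)^T == block_mx X u v d%:M) = (X^T == X) && (v == u^T).
  rewrite tr_block_mx tr_scalar_mx; apply/eqP/andP => [/eq_block_mx [-> _ -> _]|] //.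
  by case=> /eqP-> /eqP->; rewrite trmxK.
under eq_bigr => u _ do under eq_bigr => v _ do under eq_bigr => d _ do rewrite E.
case: eqP => _ /=; last by rewrite big1 // => u _; rewrite big1 // => v _; rewrite big1.
apply: eq_bigr => u _; rewrite (bigD1 u^T) //= eqxx [X in _ + X]big1 ?addr0 // => v vu.
by rewrite big1 // => d _; rewrite (negPf vu).
Qed.

Lemma sum_lambda_tr (m n : nat) (U : 'M[F]_(m, n)) :
  \sum_(K : 'M[F]_(m, n)) lambda (\tr (K^T *m U)) =
  if U == 0 then q ^+ (m * n) else 0.
Proof.
case: eqP => [->|/eqP U0].
  under eq_bigr do rewrite mulmx0 mxtrace0 lambda0 //.
  by rewrite sumr_const card_mx natrX.
have /matrix0Pn [i [j Uij]] := U0.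
have [x hx] := lambda_nontriv char3 Uij.
apply: (@char_sum0 _ predT (fun K : 'M[F]_(m, n) => lambda (\tr (K^T *m U))) (x *: delta_mx i j)) => //.
  by move=> K; rewrite linearD mulmxDl mxtraceD lambdaD.
rewrite linearZ /= trmx_delta -scalemxAl mxtraceZ.
suff -> : \tr (delta_mx j i *m U) = U i j by rewrite mulrC.
rewrite /mxtrace (bigD1 j) //= [X in _ + X]big1 ?addr0.
  rewrite mxE (bigD1 i) //= [X in _ + X]big1 ?addr0; first by rewrite mxE !eqxx mul1r.
  by move=> k ki; rewrite mxE (negPf ki) andbF mul0r.
move=> k kj; rewrite mxE big1 // => l _; by rewrite mxE (negPf kj) mul0r.
Qed.

Variable (c : F).
Hypothesis c0 : c != 0.

(** The Gauss sum of the quadratic form with matrix delta tensor X, in the 2r entries of h. *)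
Definition gauss_sum (r : nat) (X : 'M[F]_r) : algC :=
  \sum_(h : 'M[F]_(2, r)) lambda (c * \tr (X *m (h^T *m dlt *m h))).

Lemma gauss_sum_congr (r : nat) (L X : 'M[F]_r) : L \in unitmx -> gauss_sum (L *m X *m L^T) = gauss_sum X.
Proof.
move=> uL; rewrite /gauss_sum [RHS](reindex_inj (can_inj (mulmxK uL))) /=.
apply: eq_bigr => h _; congr (lambda (c * _)).
by rewrite trmx_mul -!mulmxA mxtrace_mulC -!mulmxA.
Qed.

Lemma gauss_sum_block (r s : nat) (X : 'M[F]_r) (Y : 'M[F]_s) :
  gauss_sum (block_mx X 0 0 Y) = gauss_sum X * gauss_sum Y.
Proof.
rewrite /gauss_sum sum_row_mx mulr_suml; apply: eq_bigr => h1 _.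
rewrite mulr_sumr; apply: eq_bigr => h2 _.
rewrite -lambdaD // -mulrDr; congr (lambda (c * _)).
rewrite tr_row_mx (mul_col_mx h1^T) (mul_col_row (h1^T *m dlt)) mulmx_block !mul0mx !addr0 !add0r.
by rewrite mxtrace_block.
Qed.

Lemma gauss_sum_scalar (d : F) : d != 0 -> gauss_sum (d%:M : 'M_1) = - q.
Proof.
move=> d0; rewrite -(norm_form_gauss char3 eps0 epsN (mulf_neq0 c0 d0)) pair_bigA /=.
rewrite /gauss_sum (sum_param (P := predT)
  (h := fun p : F * F => \col_(i < 2) if i == 0 then p.1 else p.2)) //.
- apply: eq_bigr => [[x y]] _; congr lambda; rewrite -mulrA; congr (_ * _).
  rewrite mul_scalar_mx mxtraceZ; congr (_ * _).
  rewrite /mxtrace !big_ord_recl !big_ord0 !mxE !big_ord_recl !big_ord0 !mxE.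
  by rewrite !big_ord_recl !big_ord0 !mxE /=; ring.
- move=> [x y] [x' y'] _ _ /= h; have := congr1 (fun M : 'cV_2 => M 0 0) h.
  by have := congr1 (fun M : 'cV_2 => M 1 0) h; rewrite !mxE /= => -> ->.
move=> u; apply/esym/existsP; exists (u 0 0, u 1 0); apply/eqP/matrixP => i j.
rewrite mxE /= (ord1 j); case: ifP => [/eqP -> //|i0]; congr (u _ _).
by apply: val_inj; case: i i0 => [[|[|//]] hw].
Qed.

(* The exponent is linear in the last column of h; summing over that column forces h v = 0. *)
Lemma gauss_sum_zero_corner (r : nat) (X : 'M[F]_r) (v : 'cV[F]_r) :
  gauss_sum (block_mx X v v^T 0) =
  q ^+ 2 * \sum_(h : 'M[F]_(2, r) | h *m v == 0) lambda (c * \tr (X *m (h^T *m dlt *m h))).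
Proof.
rewrite /gauss_sum sum_row_mx mulr_sumr [RHS]big_mkcond; apply: eq_bigr => h1 _ /=.
transitivity (\sum_(k : 'M_(2, 1)) lambda (c * \tr (X *m (h1^T *m dlt *m h1))) *
   lambda (\tr (k^T *m ((2%:R * c) *: (dlt *m (h1 *m v)))))).
  apply: eq_bigr => k _; rewrite -lambdaD //; congr lambda.
  rewrite tr_row_mx (mul_col_mx h1^T) (mul_col_row (h1^T *m dlt)) mulmx_block mxtrace_block !mxtraceD mul0mx mxtrace0 addr0.
  rewrite -scalemxAr mxtraceZ -addrA mulrDr -mulrA mulrCA; congr (_ + _ * _).
  have -> : \tr (v *m (k^T *m dlt *m h1)) = \tr (k^T *m (dlt *m (h1 *m v))).
    by rewrite mxtrace_mulC !mulmxA.
  (* The two off-diagonal blocks contribute transposes of each other, hence the factor 2, which is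
     invertible here. *)
  suff -> : \tr (v^T *m (h1^T *m dlt *m k)) = \tr (k^T *m (dlt *m (h1 *m v))) by ring.
  by rewrite -mxtrace_tr !trmx_mul !trmxK tr_delta !mulmxA.
rewrite -mulr_sumr sum_lambda_tr scalemx_eq0 mulf_eq0 (two_N1 char3) oppr_eq0 oner_eq0 (negPf c0) /=.
have -> : (dlt *m (h1 *m v) == 0) = (h1 *m v == 0).
  by apply/eqP/eqP => [/(congr1 (mulmx (invmx dlt)))|->]; rewrite ?mulKmx ?delta_unit ?mulmx0.
by case: ifP => _; rewrite ?mulr0 // mulrC.
Qed.

(** Gauss sum and invertibility are summed together, so that one recursion on the size delivers the
    number of invertible symmetric matrices and the power of -q at once. *)
Definition symsum (r : nat) : algC :=
  \sum_(X : 'M[F]_r | X^T == X) if X \in unitmx then gauss_sum X else 0.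

Lemma symsum0 : symsum 0 = 1.
Proof.
have all0 (X : 'M[F]_0) : X = 0 by apply/matrixP => - [].
rewrite /symsum (big_pred1 0) => [|X]; last by rewrite [X]all0 trmx0 /= !eqxx.
rewrite unitmxE det_mx00 unitr1 /gauss_sum (big_pred1 0) => [|h].
  by rewrite mul0mx mxtrace0 mulr0 lambda0.
by apply/esym/eqP/matrixP => i [].
Qed.

Lemma unitmx_congr (r : nat) (L X : 'M[F]_r) :
  L \in unitmx -> (L *m X *m L^T \in unitmx) = (X \in unitmx).
Proof. by move=> uL; rewrite !unitmx_mul unitmx_tr uL andbT. Qed.

(* Schur complement of the corner d. *)
Lemma symsum_corner_unit (r : nat) (v : 'cV[F]_r) (d : F) : d != 0 ->
  \sum_(X | X^T == X)
    (if block_mx X v v^T d%:M \in unitmx then gauss_sum (block_mx X v v^T d%:M) else 0) =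
  - q * symsum r.
Proof.
move=> d0; rewrite mulr_sumr (reindex_inj (addrI (d^-1 *: (v *m v^T)))) /=.
apply: eq_big => Y.
  rewrite linearD linearZ /= trmx_mul trmxK.
  by rewrite (inj_eq (addrI _)).
move=> _; set L : 'M_(r + 1) := block_mx 1%:M (d^-1 *: v) 0 1%:M.
have uL : L \in unitmx by rewrite unitmxE det_ublock !det1 mulr1 unitr1.
have -> : block_mx (d^-1 *: (v *m v^T) + Y) v v^T d%:M =
          L *m block_mx Y 0 0 d%:M *m L^T.
  rewrite /L tr_block_mx !mulmx_block !(mul1mx, mulmx1, mul0mx, mulmx0, addr0, add0r, trmx1, trmx0).
  rewrite -!scalemxAl !mul_mx_scalar !mul_scalar_mx linearZ /= !scalerA mulVf // divff //.
  by rewrite !scale1r -scalemxAl scalerA mulVf // scale1r -scalemxAr addrC.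
rewrite unitmx_congr // gauss_sum_congr // gauss_sum_block gauss_sum_scalar // mulrC.
rewrite !unitmxE det_ublock det_scalar1 unitrM [d \is a _]unitfE d0 andbT.
by case: ifP; rewrite ?mulr0.
Qed.

(* A congruence moves v to the last basis vector; then the first s coordinates split off. *)
Lemma symsum_corner_zero (s : nat) (v : 'cV[F]_(s + 1)) : v != 0 ->
  \sum_(X | X^T == X)
    (if block_mx X v v^T 0 \in unitmx then gauss_sum (block_mx X v v^T 0) else 0) =
  q ^+ (s + 1) * q ^+ 2 * symsum s.
Proof.
move=> v0; pose e : 'cV[F]_(s + 1) := col_mx 0 1%:M.
have [g ug gv] : {g : 'M_(s + 1) | g \in unitmx & v = g *m e}.
  have e0 : e != 0 by rewrite col_mx_eq0 negb_and -[1%:M]/1 oner_eq0 orbT.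
  have ee : e^T *m e = 1%:M by rewrite tr_col_mx trmx0 trmx1 mul_row_col mulmx1 mul0mx add0r.
  (* [e *m v^T] sends e^T to v^T; both rows have rank one, so some invertible matrix acts on e^T in
     the same way. *)
  have rk : \rank (e^T *m (e *m v^T)) = \rank e^T.
    by rewrite mulmxA ee mul1mx !rank_rV !trmx_eq0 v0 e0.
  have [g ug eg] := complete_unitmx rk.
  exists g^T; rewrite ?unitmx_tr //.
  by apply: trmx_inj; rewrite trmx_mul trmxK -eg mulmxA ee mul1mx.
rewrite (reindex (fun Y => g *m Y *m g^T)) /=; last first.
  exists (fun X => invmx g *m X *m (invmx g)^T) => Y _.
    by rewrite !mulmxA mulVmx // mul1mx -mulmxA -trmx_mul mulVmx // trmx1 mulmx1.
  by rewrite !mulmxA mulmxV // mul1mx -mulmxA -trmx_mul mulmxV // trmx1 mulmx1.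
set L : 'M_(s + 1 + 1) := block_mx g 0 0 1%:M.
have uL : L \in unitmx by rewrite unitmxE det_ublock det1 mulr1 -unitmxE.
transitivity (\sum_(Y | Y^T == Y)
    (if block_mx Y e e^T 0 \in unitmx then gauss_sum (block_mx Y e e^T 0) else 0)).
  apply: eq_big => Y.
    rewrite !trmx_mul trmxK mulmxA.
    apply/eqP/eqP => [|->//] H.
    apply: (can_inj (mulKmx ug)); apply: (can_inj (mulmxK (_ : g^T \in unitmx))) => //.
    by rewrite unitmx_tr.
  move=> _; have -> : block_mx (g *m Y *m g^T) v v^T 0 = L *m block_mx Y e e^T 0 *m L^T.
    rewrite /L tr_block_mx !mulmx_block !(mul1mx, mulmx1, mul0mx, mulmx0, addr0, add0r, trmx1, trmx0).
    by rewrite gv trmx_mul.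
  by rewrite unitmx_congr // gauss_sum_congr.
rewrite sum_sym_block mulr_sumr.
apply: eq_bigr => Z _.
rewrite -mulrA exprD expr1.
transitivity (\sum_(y : 'cV[F]_s) \sum_(x : F) q ^+ 2 * (if Z \in unitmx then gauss_sum Z else 0)).
  apply: eq_bigr => y _; apply: eq_bigr => x _.
  have -> : (block_mx (block_mx Z y y^T x%:M) e e^T 0 \in unitmx) = (Z \in unitmx).
    pose P : 'M[F]_(s + 1) := block_mx 1%:M 0 0 0.
    (* The permutation matrix exchanging the last two coordinates. Multiplying by it leaves a block
       triangular matrix with diagonal blocks Z, 1, 1. *)
    pose W : 'M[F]_(s + 1 + 1) := block_mx P e e^T 0.
    have eP : e^T *m P = 0.
      by rewrite tr_col_mx trmx0 trmx1 mul_row_block !mulmx0 !mul0mx !addr0 row_mx0.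
    have ee : e^T *m e = 1%:M by rewrite tr_col_mx trmx0 trmx1 mul_row_col mulmx1 mul0mx add0r.
    have eeT : e *m e^T = block_mx 0 0 0 1%:M.
      by rewrite tr_col_mx trmx0 trmx1 mul_col_row !mulmx0 !mul0mx mulmx1.
    have uW : W \in unitmx.
      have: W *m W = 1%:M.
        rewrite mulmx_block eP ee eeT !mulmx0 !addr0.
        rewrite /P /e mulmx_block mul_block_col !(mul1mx, mulmx1, mul0mx, mulmx0, addr0, add0r).
        by rewrite add_block_mx !(addr0, add0r) col_mx0 -!scalar_mx_block.
      by case/mulmx1_unit.
    rewrite -[LHS]andbT -{1}uW -unitmx_mul mulmx_block eP ee !mul0mx !addr0 !unitmxE det_ublock det1 mulr1.
    rewrite eeT mulmx_block add_block_mx !(mul1mx, mulmx1, mul0mx, mulmx0, addr0, add0r).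
    by rewrite det_lblock det1 mulr1.
  case: ifP => _; last by rewrite mulr0.
  (* Multiplying h by e extracts its last column; when that vanishes, the Gauss sum of Z remains. *)
  rewrite gauss_sum_zero_corner; congr (_ * _); rewrite big_mkcond sum_row_mx; apply: eq_bigr => h _.
  rewrite (bigD1 0) //= [X in _ + X]big1 ?addr0 => [|k k0].
    rewrite mul_row_col mulmx0 mul0mx addr0 eqxx; congr (lambda (_ * _)).
    rewrite tr_row_mx trmx0 (mul_col_mx h^T) mul0mx (mul_col_row (h^T *m dlt)) mulmx_block mxtrace_block.
    by rewrite !(mul0mx, mulmx0, addr0, mxtrace0).
  by rewrite mul_row_col mulmx0 add0r mulmx1 (negPf k0).
rewrite !sumr_const !card_mx muln1 -[LHS]mulr_natl -[X in _ * X]mulr_natl natrX.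
by rewrite !mulrA.
Qed.

(** The sum is split by the corner d. The q - 1 nonzero values contribute equally for each of the
    q^r vectors v; for d = 0 the vector v = 0 gives a singular matrix. *)
Lemma symsum_rec (r : nat) :
  symsum (r + 1) = q ^+ r * (q - 1) * (- q) * symsum r +
    \sum_(v : 'cV_r | v != 0) \sum_(X | X^T == X)
      (if block_mx X v v^T 0 \in unitmx then gauss_sum (block_mx X v v^T 0) else 0).
Proof.
rewrite {1}/symsum sum_sym_block exchange_big /=.
transitivity (\sum_(v : 'cV[F]_r) (- q * symsum r * (q - 1) + \sum_(X | X^T == X)
      (if block_mx X v v^T 0 \in unitmx then gauss_sum (block_mx X v v^T 0) else 0))).
  apply: eq_bigr => v _; rewrite exchange_big (bigD1 (0 : F)) //= addrC raddf0.
  congr (_ + _); rewrite (eq_bigr _ (fun d => @symsum_corner_unit r v d)).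
  by rewrite sumr_const (cardC1 (0 : F)) -subn1 -[LHS]mulr_natr natrB ?(card_gt0 char3).
rewrite big_split /= sumr_const card_mx muln1; congr (_ + _).
  by rewrite -[LHS]mulr_natl natrX; ring.
rewrite (bigD1 0) //= [X in X + _]big1 ?add0r // => X _.
by rewrite unitmxE trmx0 det_ublock det0 mulr0 unitr0.
Qed.

Lemma symsum1 : symsum 1 = (q - 1) * - q.
Proof.
rewrite (symsum_rec 0) symsum0 expr0 mul1r mulr1 big_pred0 ?addr0 // => v.
by apply/negbTE; rewrite negbK; apply/eqP/matrixP => - [].
Qed.

Lemma symsum_rec2 (s : nat) :
  symsum s.+2 = q ^+ s.+1 * (q - 1) * (- q) * symsum s.+1 +
    (q ^+ s.+1 - 1) * q ^+ s.+1 * q ^+ 2 * symsum s.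
Proof.
have -> : s.+2 = (s + 1 + 1)%N by rewrite !addn1.
rewrite symsum_rec -[s.+1]addn1; congr (_ + _).
rewrite (eq_bigr _ (@symsum_corner_zero s)) sumr_const.
rewrite (cardC1 (0 : 'cV_(s + 1))) card_mx muln1 -subn1 -[LHS]mulr_natl natrB ?expn_gt0 ?(card_gt0 char3) //.
by rewrite natrX !mulrA.
Qed.

Definition odd_prod (k : nat) : nat :=
  (\prod_(1 <= j < k.+1) (#|F| ^ (2 * j - 1) - 1))%N.

Lemma odd_prodS k : (odd_prod k.+1)%:R = (odd_prod k)%:R * (q ^+ (2 * k) * q - 1).
Proof.
rewrite /odd_prod big_nat_recr //= natrM; congr (_ * _).
rewrite natrB ?expn_gt0 ?(card_gt0 char3) // natrX -exprSr; congr (_ ^+ _ - _).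
lia.
Qed.

(** The recursion has order two, so both parities are carried through the induction. Besides (-q) to
    the size, the factor is the number of invertible symmetric matrices. *)
Lemma symsum_closed k :
  symsum (2 * k) = q ^+ (2 * k) * (q ^+ (k * k.+1) * (odd_prod k)%:R) /\
  symsum (2 * k).+1 = - (q ^+ (2 * k).+1 * (q ^+ (k * k.+1) * (odd_prod k.+1)%:R)).
Proof.
elim: k => [|k [IH0 IH1]].
  rewrite muln0 symsum0 symsum1 odd_prodS /odd_prod big_geq // muln0 !expr0.
  by split; ring.
have IH2 : symsum (2 * k.+1) = q ^+ (2 * k.+1) * (q ^+ (k.+1 * k.+2) * (odd_prod k.+1)%:R).
  have e1 : (2 * k.+1 = (2 * k).+2)%N by lia.
  have e2 : (k.+1 * k.+2 = k * k.+1 + (2 * k).+2)%N by lia.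
  rewrite e1 symsum_rec2 IH0 IH1 e2 odd_prodS exprD !exprS.
  by ring.
split=> //; have e1 : (2 * k.+1 = (2 * k).+2)%N by lia.
have e2 : (k.+1 * k.+2 = k * k.+1 + (2 * k).+2)%N by lia.
rewrite {1}e1 symsum_rec2 -e1 IH2 IH1 (odd_prodS k.+1) e2 exprD e1 !exprS.
by ring.
Qed.

End SymmetricGauss.

(** * The parabolic subgroup Q *)

Section Blocks.
Variables (F : finFieldType) (m : nat).
Implicit Types (a b d e : 'M[F]_m) (c f : 'M[F]_(m, 2)) (g h : 'M[F]_(2, m)) (i : 'M[F]_2).

Lemma blk3M a b c d e f g h i a' b' c' d' e' f' g' h' i' :
  blk3 m a b c d e f g h i *m blk3 m a' b' c' d' e' f' g' h' i' =
  blk3 m (a *m a' + b *m d' + c *m g') (a *m b' + b *m e' + c *m h') (a *m c' + b *m f' + c *m i')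
         (d *m a' + e *m d' + f *m g') (d *m b' + e *m e' + f *m h') (d *m c' + e *m f' + f *m i')
         (g *m a' + h *m d' + i *m g') (g *m b' + h *m e' + i *m h') (g *m c' + h *m f' + i *m i').
Proof.
rewrite /blk3 [LHS]mulmx_block; congr (block_mx _ _ _ _).
- by rewrite mulmx_block mul_col_row add_block_mx.
- by rewrite mul_block_col mul_col_mx add_col_mx.
- by rewrite mul_row_block mul_mx_row add_row_mx.
by rewrite mul_row_col.
Qed.

Lemma blk3T a b c d e f g h i :
  (blk3 m a b c d e f g h i)^T = blk3 m a^T d^T g^T b^T e^T h^T c^T f^T i^T.
Proof. by rewrite /blk3 tr_block_mx tr_block_mx tr_col_mx tr_row_mx. Qed.

Lemma blk3_inj a b c d e f g h i a' b' c' d' e' f' g' h' i' :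
  blk3 m a b c d e f g h i = blk3 m a' b' c' d' e' f' g' h' i' ->
  [/\ [/\ a = a', b = b' & c = c'], [/\ d = d', e = e' & f = f'] & [/\ g = g', h = h' & i = i']].
Proof.
case/eq_block_mx => /eq_block_mx [-> -> -> ->] /eq_col_mx [-> ->] /eq_row_mx [-> ->] ->.
by [].
Qed.

Lemma blk3_tr a b c d e f g h i :
  \tr (blk3 m a b c d e f g h i) = \tr a + \tr e + \tr i.
Proof. by rewrite /blk3 !mxtrace_block. Qed.

Lemma blk3_1 : blk3 m 1%:M 0 0 0 1%:M 0 0 0 1%:M = 1%:M :> 'M[F]_(m + m + 2).
Proof. by rewrite /blk3 -scalar_mx_block col_mx0 row_mx0 -scalar_mx_block. Qed.
End Blocks.

Definition mx_simpl := (mul1mx, mulmx1, mul0mx, mulmx0, addr0, add0r, trmx1, trmx0).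

Section Parabolic.
Variables (F : finFieldType) (eps : F) (m : nat).
Hypotheses (char3 : 3%N \in [pchar F]) (eps0 : eps != 0) (epsN : ~~ is_square eps).
Local Notation dlt := (delta eps).
Local Notation J := (Jmat eps m).

Definition qmat (A : 'M[F]_m) (i : 'M[F]_2) (h : 'M[F]_(2, m)) (B : 'M[F]_m) :=
  blk3 m A (A *m B) (- (A *m h^T *m dlt)) 0 (invmx A)^T 0 0 (i *m h) i.

Lemma qmatE A i h B :
  blk3 m A 0 0 0 (invmx A)^T 0 0 0 i *m
  blk3 m 1%:M B (- (h^T *m dlt)) 0 1%:M 0 0 h 1%:M = qmat A i h B.
Proof. by rewrite blk3M !mx_simpl mulmxN mulmxA. Qed.

Lemma in_QP (w : 'M[F]_(m + m + 2)) :
  reflect (exists A i B h, [/\ A \in unitmx, in_SO2minus eps i,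
      B^T + B + h^T *m dlt *m h = 0 & w = qmat A i h B]) (w \in Qset eps m).
Proof.
rewrite inE; apply: (iffP existsP).
  move=> [A /existsP[i /existsP[B /existsP[h /and4P[uA so /eqP e /eqP ->]]]]].
  by exists A, i, B, h; rewrite -qmatE.
move=> [A [i [B [h [uA so e ->]]]]].
exists A; apply/existsP; exists i; apply/existsP; exists B; apply/existsP; exists h.
by rewrite uA so e qmatE !eqxx.
Qed.

Lemma Jform_blk (a b c e f h i : _) :
  (blk3 m a b c 0 e f 0 h i)^T *m J *m (blk3 m a b c 0 e f 0 h i) =
  blk3 m 0 (a^T *m e) (a^T *m f)
    (e^T *m a) (e^T *m b + b^T *m e + h^T *m dlt *m h) (e^T *m c + b^T *m f + h^T *m dlt *m i)
    (f^T *m a) (f^T *m b + c^T *m e + i^T *m dlt *m h) (f^T *m c + c^T *m f + i^T *m dlt *m i).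
Proof. by rewrite blk3T /Jmat !blk3M !mx_simpl. Qed.

(* The block f is left free because it comes for free: preservation of J forces f = 0. *)
Lemma in_Q_char (w : 'M[F]_(m + m + 2)) :
  w \in Qset eps m <->
  w^T *m J *m w = J /\
  exists a b c e f h i, w = blk3 m a b c 0 e f 0 h i /\ \det i = 1.
Proof.
have du := delta_unit eps0.
split.
  case/in_QP => A [i [B [h [uA so e ->]]]].
  have /and3P[ui /eqP ip /eqP di] := so.
  split; last by do 7!eexists; split; [reflexivity | exact: di].
  rewrite Jform_blk /Jmat !mx_simpl trmxK mulVmx //.
  rewrite -trmx_mul mulVmx // trmx1.
  have hd : (i *m h)^T *m dlt *m i = h^T *m dlt.
    by rewrite trmx_mul -!mulmxA [i^T *m _]mulmxA ip.
  have hd' : i^T *m dlt *m (i *m h) = dlt *m h by rewrite mulmxA ip.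
  congr blk3.
  - by rewrite -trmx_mul !mulKmx // mulmxA hd [B + _]addrC.
  - by rewrite hd mulmxN -!mulmxA mulKmx // addNr.
  - rewrite hd' linearN /= !trmx_mul trmxK tr_delta mulNmx -!mulmxA -trmx_mul.
    by rewrite mulVmx // trmx1 mulmx1 addNr.
  - exact: ip.
case=> hJ [a [b [c [e [f [h [i [hw di]]]]]]]].
move: hJ; rewrite hw Jform_blk => /blk3_inj [[_ h12 h13] [_ h22 h23] [_ _ h33]].
have [ua ue] := mulmx1_unit h12; rewrite unitmx_tr in ua.
have f0 : f = 0 by apply: (can_inj (mulKmx (_ : a^T \in unitmx))); rewrite ?unitmx_tr // h13 mulmx0.
have eV : e = (invmx a)^T.
  by apply: (can_inj (mulKmx (_ : a^T \in unitmx))); rewrite ?unitmx_tr // h12 -trmx_mul mulVmx // trmx1.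
move: h22 h23 h33; rewrite f0 eV trmxK !mx_simpl => h22 h23 h33.
have ui : i \in unitmx by rewrite unitmxE di unitr1.
apply/in_QP; exists a, i, (invmx a *m b), (invmx i *m h).
have iV : (invmx i)^T *m dlt = dlt *m i.
  by rewrite -[in LHS]h33 -!mulmxA [_^T *m (_^T *m _)]mulmxA -trmx_mul mulmxV // trmx1 mul1mx.
have hV : (invmx i *m h)^T *m dlt = h^T *m dlt *m i.
  by rewrite trmx_mul -!mulmxA iV.
split=> //.
- by rewrite /in_SO2minus ui h33 di !eqxx.
- rewrite hV [_^T + _]addrC trmx_mul -[_ *m i *m _]mulmxA mulKVmx //.
rewrite /qmat !mulKVmx //; congr blk3; rewrite -mulmxA hV -mulmxN.
by apply: (can_inj (mulKVmx ua)); rewrite mulKmx //; apply/eqP; rewrite -addr_eq0 h23.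
Qed.

Lemma Jmat_unit : J \in unitmx.
Proof.
have: J *m blk3 m 0 1%:M 0 1%:M 0 0 0 0 (invmx dlt) = 1%:M.
  by rewrite /Jmat blk3M !mx_simpl mulmxV ?delta_unit // blk3_1.
by case/mulmx1_unit.
Qed.

Lemma Q_unit w : w \in Qset eps m -> w \in unitmx.
Proof.
case/in_Q_char => e _.
have: (invmx J *m w^T *m J) *m w = 1%:M.
  by rewrite -!mulmxA [w^T *m _]mulmxA e mulVmx // Jmat_unit.
by case/mulmx1_unit.
Qed.

(** Isometries and the triangular shape are both stable under products. The right factor is taken in
    explicit form: its zero block f makes the last corner of the product i i', of determinant 1. *)
Lemma Q_mul w w' : w \in Qset eps m -> w' \in Qset eps m -> w *m w' \in Qset eps m.
Proof.
move=> /in_Q_char [e [a [b [c [d [f [h [i [E di]]]]]]]]].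
move=> /[dup] /in_Q_char [e' _] /in_QP [A' [i' [B' [h' [_ /and3P[_ _ /eqP di'] _ E']]]]].
apply/in_Q_char; split.
  by rewrite trmx_mul -!mulmxA [J *m _]mulmxA [w^T *m _]mulmxA [w^T *m _]mulmxA e mulmxA.
rewrite E E' blk3M !mx_simpl; do 7!eexists; split; first by reflexivity.
by rewrite det_mulmx di di' mulr1.
Qed.

Lemma Q_1 : 1%:M \in Qset eps m.
Proof.
apply/in_Q_char; split; first by rewrite trmx1 mul1mx mulmx1.
by rewrite -blk3_1; do 7!eexists; split; [reflexivity | exact: det1].
Qed.

Lemma skew_shift (h : 'M[F]_(2, m)) (S : 'M[F]_m) :
  (h^T *m dlt *m h + S)^T + (h^T *m dlt *m h + S) + h^T *m dlt *m h = S^T + S.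
Proof.
rewrite linearD /= !trmx_mul trmxK tr_delta !mulmxA.
set X := h^T *m _ *m _.
move: X => X; apply/matrixP => u v; rewrite !mxE.
by apply: (eq_mod3 char3 (c := X u v)); ring.
Qed.

Lemma sum_Q (f : 'M[F]_(m + m + 2) -> algC) :
  \sum_(w in Qset eps m) f w =
  \sum_(A | A \in unitmx) \sum_(i | in_SO2minus eps i) \sum_h \sum_(S | S^T == - S)
     f (qmat A i h (h^T *m dlt *m h + S)).
Proof.
rewrite pair_big_dep /=; under [RHS]eq_bigr => p _ do rewrite pair_big_dep /=.
rewrite pair_big_dep /=.
rewrite (sum_param (P := fun p : 'M[F]_m * 'M[F]_2 * ('M[F]_(2, m) * 'M[F]_m) =>
    (p.1.1 \in unitmx) && in_SO2minus eps p.1.2 && (true && (p.2.2^T == - p.2.2)))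
  (h := fun p => qmat p.1.1 p.1.2 p.2.1 (p.2.1^T *m dlt *m p.2.1 + p.2.2))) //.
- move=> [[A i] [h S]] [[A' i'] [h' S']] /andP[/andP[/= uA /and3P[ui _ _]] _] _ /=.
  case/blk3_inj => - [<- hB _] _ [_ hh ei]; rewrite -ei in hh.
  have eh : h = h' by apply: (can_inj (mulKmx ui)).
  rewrite -eh in hB; congr (_, _, (_, _)) => //.
  by apply: (addrI (h^T *m dlt *m h)); apply: (can_inj (mulKmx uA)).
move=> w; apply/in_QP/existsP.
  move=> [A [i [B [h [uA so e ->]]]]]; exists ((A, i), (h, B - h^T *m dlt *m h)) => /=.
  rewrite uA so /= -addr_eq0 -(skew_shift h).
  have -> : h^T *m dlt *m h + (B - h^T *m dlt *m h) = B by rewrite addrC subrK.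
  by rewrite e !eqxx.
move=> [[[A i] [h S]] /= /andP[/andP[/andP[uA so] sS] /eqP ->]].
do 4!eexists; split; [exact: uA | exact: so | | reflexivity].
by rewrite skew_shift; apply/eqP; rewrite addr_eq0.
Qed.

(** If M is symmetric, tr (M S) is its own opposite and vanishes. Otherwise some M i j differs from
    M j i, and translation by a suitable multiple of E_ij - E_ji kills the sum. *)
Lemma skew_orth (M : 'M[F]_m) :
  \sum_(S : 'M[F]_m | S^T == - S) lambda (\tr (M *m S)) =
  if M^T == M then #|[set S : 'M[F]_m | S^T == - S]|%:R else 0.
Proof.
case: eqP => [sM | /eqP nM].
  rewrite cardsE -sum1_card natr_sum; apply: eq_bigr => S /eqP sS.
  suff -> : \tr (M *m S) = 0 by rewrite lambda0.
  have e : \tr (M *m S) = - \tr (M *m S).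
    by rewrite -[LHS]mxtrace_tr trmx_mul sM sS mulNmx mxtrace_mulC linearN.
  apply: (eq_mod3 char3 (c := \tr (M *m S))); rewrite add0r.
  have -> : 3%:R * \tr (M *m S) = \tr (M *m S) + (\tr (M *m S) + \tr (M *m S)) by ring.
  by rewrite {3}e addNr addr0.
have /matrix0Pn [i [j Mij]] : M^T - M != 0 by rewrite subr_eq0.
have [x hx] := lambda_nontriv char3 Mij.
pose S0 : 'M[F]_m := x *: (delta_mx i j - delta_mx j i).
have sS0 : S0^T = - S0.
  by rewrite /S0 linearZ /= linearB /= !trmx_delta -scalerN opprB.
apply: (@char_sum0 _ (fun S : 'M[F]_m => S^T == - S) (fun S => lambda (\tr (M *m S))) S0).
- by move=> S; rewrite linearD /= sS0 opprD (inj_eq (addrI _)).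
- by move=> S; rewrite mulmxDr mxtraceD lambdaD.
have trd u v : \tr (M *m delta_mx u v) = M v u.
  rewrite mxtrace_mulC /mxtrace (bigD1 u) //= [X in _ + X]big1 ?addr0.
    rewrite mxE (bigD1 v) //= [X in _ + X]big1 ?addr0; first by rewrite mxE !eqxx mul1r.
    by move=> k kv; rewrite mxE (negPf kv) andbF mul0r.
  by move=> k ku; rewrite mxE big1 // => l _; rewrite mxE (negPf ku) mul0r.
rewrite /S0 -scalemxAr mxtraceZ mulmxBr linearB /= !trd mulrC.
by rewrite !mxE in hx.
Qed.

End Parabolic.

(** * Sums over double cosets *)

Section DoubleCoset.
Variables (F : finFieldType) (k : nat) (G : {set 'M[F]_k}) (s : 'M[F]_k).
Hypotheses (unitG : {in G, forall x, x \in unitmx})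
  (mulG : {in G &, forall x y, x *m y \in G}) (oneG : 1%:M \in G) (ss : s *m s = 1%:M).

(** Left multiplication by x is injective on the finite set G, hence onto it; so G is closed under
    inverses. *)
Lemma submonoid_mulr (x y : 'M[F]_k) : x \in G -> (x *m y \in G) = (y \in G).
Proof.
move=> xG; apply/idP/idP => [xyG|]; last exact: mulG.
have injx : injective (mulmx x : 'M[F]_k -> 'M[F]_k) := can_inj (mulKmx (unitG xG)).
have imG : [set x *m z | z in G] = G.
  apply/eqP; rewrite eqEcard card_imset // leqnn andbT.
  by apply/subsetP => _ /imsetP[z zG ->]; apply: mulG.
by move: xyG; rewrite -{1}imG => /imsetP[z zG /injx ->].
Qed.

Lemma submonoid_inv (x : 'M[F]_k) : x \in G -> invmx x \in G.
Proof. by move=> xG; rewrite -(submonoid_mulr _ xG) mulmxV ?unitG. Qed.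

(** Each fibre of the map taking (x, y) to x s y is a torsor under the intersection of G with s G s,
    where z acts by (x z^-1, s z s y); the product is unchanged because s is an involution. *)
Lemma double_coset_sum (f : 'M[F]_k -> algC) :
  \sum_(x in G) \sum_(y in G) f (x *m s *m y) =
  #|[set z in G | s *m z *m s \in G]|%:R *
    \sum_(g in [set x *m s *m y | x in G, y in G]) f g.
Proof.
set P := [set z in G | _]; set D := imset2 _ _ _.
rewrite pair_big /= (partition_big (fun p => p.1 *m s *m p.2) (fun g => g \in D)) /=; last first.
  by move=> [x y] /andP[xG yG]; apply/imset2P; exists x y.
rewrite mulr_sumr; apply: eq_bigr => _ /imset2P[x y xG yG ->].
rewrite (eq_bigr (fun _ => f (x *m s *m y))) => [|p /andP[_ /eqP ->] //].
have ux := unitG xG; have uy := unitG yG.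
rewrite (sum_param (P := fun z => z \in P)
   (h := fun z => (x *m invmx z, s *m z *m s *m y))) => [| |[x' y'] /=].
- by rewrite sumr_const mulr_natl.
- by move=> z z' _ _ [/(can_inj (mulKmx ux)) /(can_inj invmxK)].
apply/idP/existsP.
  case/andP => /andP[x'G y'G] /eqP e.
  have ux' := unitG x'G; have uy' := unitG y'G.
  pose z := invmx x' *m x.
  have zG : z \in G by rewrite mulG ?submonoid_inv.
  have ey : s *m z *m s *m y = y'.
    have -> : s *m z *m s *m y = s *m (invmx x' *m (x *m s *m y)) by rewrite /z !mulmxA.
    by rewrite -e -mulmxA mulKmx // mulmxA ss mul1mx.
  have szs : s *m z *m s = y' *m invmx y by rewrite -ey mulmxK.
  exists z; rewrite inE zG szs mulG ?submonoid_inv //= -szs ey.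
  by apply/eqP; congr (_, _); rewrite -[LHS](mulmxK (unitG zG)) /z mulKVmx.
case=> z /andP[]; rewrite inE => /andP[zG szsG] /eqP[-> ->].
have -> : x *m invmx z \in G by rewrite mulG ?submonoid_inv.
have -> : s *m z *m s *m y \in G by apply: mulG.
apply/eqP.
by rewrite -!mulmxA; congr (_ *m _); rewrite [s *m (s *m _)]mulmxA ss mul1mx mulKmx ?unitG.
Qed.

Lemma double_coset_tr (phi : F -> algC) :
  #|G|%:R * \sum_(w in G) phi (\tr (w *m s)) =
  #|[set z in G | s *m z *m s \in G]|%:R *
    \sum_(g in [set x *m s *m y | x in G, y in G]) phi (\tr g).
Proof.
rewrite -(double_coset_sum (fun g => phi (\tr g))) exchange_big /=.
rewrite -sum1_card natr_sum mulr_suml; apply: eq_bigr => y yG; rewrite mul1r.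
have injy : injective (mulmx y : 'M[F]_k -> 'M[F]_k) := can_inj (mulKmx (unitG yG)).
rewrite (reindex_inj injy) /=; apply: eq_big => x; first exact: submonoid_mulr.
by move=> _; rewrite -!mulmxA mxtrace_mulC -!mulmxA.
Qed.
End DoubleCoset.

(** * The element sigma_{n-2} *)

Section Sigma.
Variables (F : finFieldType) (r : nat).
Local Notation sg := (@sigma F (r + 1) r).

(* Projections onto the coordinates moved, respectively fixed, by sigma_r. *)
Definition prl : 'M[F]_(r + 1) := block_mx 1%:M 0 0 0.
Definition prr : 'M[F]_(r + 1) := block_mx 0 0 0 1%:M.

Lemma prlE a b : prl a b = ((a == b) && (a < r)%N)%:R.
Proof.
rewrite /prl; case: (split_ordP a) => a' ->; case: (split_ordP b) => b' ->;
  have ha := ltn_ord a'; have hb := ltn_ord b';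
  rewrite ?(block_mxEul, block_mxEur, block_mxEdl, block_mxEdr, mxE) -?val_eqE /=.
- by rewrite andbT.
- by rewrite (_ : _ && _ = false) //; lia.
- by rewrite (_ : _ && _ = false) //; lia.
by rewrite (_ : _ && _ = false) //; lia.
Qed.

(** Here n = r + 2, so the block size r + 1 is n - 1 and sigma_{n-2} fixes a single coordinate in
    each half. *)
Lemma sigma_blk : sg = blk3 (r + 1) prr prl 0 prl prr 0 0 0 1%:M.
Proof.
have prrE a b : prr a b = ((a == b) && ~~ (a < r)%N)%:R.
  have -> : prr = 1%:M - prl.
    by rewrite /prr /prl (scalar_mx_block r 1) opp_block_mx add_block_mx !oppr0 subrr !addr0.
  by rewrite [LHS]mxE [1%:M _ _]mxE [(- prl) _ _]mxE prlE; case: eqP => /= _; case: (a < r)%N; rewrite ?subrr ?subr0.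
have E (c c' : bool) : c = c' -> (if c then 1 else 0 : F) = c'%:R by move=> ->; case: c'.
move: prl prr prlE prrE => pl pr plE prE.
apply/matrixP => i j; rewrite mxE /blk3.
case: (split_ordP i) => [i1|i1] ->; [case: (split_ordP i1) => [a|a] ->|];
case: (split_ordP j) => [j1|j1] ->; try (case: (split_ordP j1) => [b|b] ->);
rewrite ?(block_mxEul, block_mxEur, block_mxEdl, block_mxEdr, col_mxEu, col_mxEd, row_mxEl, row_mxEr, plE, prE, mxE) -?val_eqE /=.
all: try (have ha := ltn_ord a).
all: try (have hb := ltn_ord b).
all: try (have hi := ltn_ord i1).
all: try (have hj := ltn_ord j1).
all: try (apply: E; rewrite -?val_eqE /=; lia).
all: by case: ifP => // H; exfalso; lia.
Qed.

Lemma prl_prl : prl *m prl = prl.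
Proof. by rewrite /prl mulmx_block !mx_simpl. Qed.
Lemma prl_prr : prl *m prr = 0.
Proof. by rewrite /prl /prr mulmx_block !mx_simpl block_mx0. Qed.
Lemma prr_prl : prr *m prl = 0.
Proof. by rewrite /prl /prr mulmx_block !mx_simpl block_mx0. Qed.
Lemma prr_prr : prr *m prr = prr.
Proof. by rewrite /prr mulmx_block !mx_simpl. Qed.
Lemma prl_add_prr : prl + prr = 1%:M.
Proof. by rewrite /prl /prr add_block_mx !mx_simpl -scalar_mx_block. Qed.
Lemma prl_tr : prl^T = prl.
Proof. by rewrite /prl tr_block_mx !mx_simpl. Qed.
Lemma prr_tr : prr^T = prr.
Proof. by rewrite /prr tr_block_mx !mx_simpl. Qed.

Lemma sigma_sigma : sg *m sg = 1%:M.
Proof.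
rewrite sigma_blk blk3M !mx_simpl prl_prl prr_prr prl_prr prr_prl !mx_simpl.
by rewrite [prr + _]addrC prl_add_prr blk3_1.
Qed.

Lemma sigma_tr : sg^T = sg.
Proof. by rewrite sigma_blk blk3T !mx_simpl prl_tr prr_tr. Qed.

Variable eps : F.
Hypothesis eps0 : eps != 0.
Local Notation dlt := (delta eps).
Local Notation J := (Jmat eps (r + 1)).
Local Notation Q := (Qset eps (r + 1)).

Lemma sigma_J : sg *m J *m sg = J.
Proof.
rewrite sigma_blk /Jmat !blk3M !mx_simpl prl_prl prr_prr prl_prr prr_prl !mx_simpl.
by rewrite prl_add_prr [prr + _]addrC prl_add_prr.
Qed.

Lemma lower_block_unit (X : 'M[F]_r) (v : 'rV_r) (d : F) :
  (block_mx X 0 v d%:M \in unitmx) = (X \in unitmx) && (d != 0).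
Proof. by rewrite unitmxE det_lblock det_scalar1 unitrM -unitmxE unitfE. Qed.

Lemma lower_block_inv (X : 'M[F]_r) (v : 'rV_r) (d : F) :
  X \in unitmx -> d != 0 ->
  exists w, invmx (block_mx X 0 v d%:M) = block_mx (invmx X) 0 w (d^-1)%:M.
Proof.
move=> uX d0; exists (- d^-1 *: (v *m invmx X)).
have uA : block_mx X 0 v d%:M \in unitmx by rewrite lower_block_unit uX.
apply: (can_inj (mulKmx uA)); rewrite mulmxV // mulmx_block !mx_simpl mulmxV //.
rewrite mul_scalar_mx scalerA mulrN divff // scaleN1r addrN -scalar_mxM divff //.
by rewrite -scalar_mx_block.
Qed.

Lemma conj_sigma_blk a b c e h i :
  sg *m blk3 (r + 1) a b c 0 e 0 0 h i *m sg =
  blk3 (r + 1) (prr *m a *m prr + (prr *m b + prl *m e) *m prl)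
    (prr *m a *m prl + (prr *m b + prl *m e) *m prr) (prr *m c)
    (prl *m a *m prr + (prl *m b + prr *m e) *m prl)
    (prl *m a *m prl + (prl *m b + prr *m e) *m prr) (prl *m c)
    (h *m prl) (h *m prr) i.
Proof. by rewrite sigma_blk !blk3M !mx_simpl. Qed.

(** Since sigma preserves J, [in_Q_char] reduces membership to shape: the two blocks below the first
    diagonal block must vanish. *)
Lemma conj_sigma_Q (A : 'M[F]_(r + 1)) i h B :
  A \in unitmx -> in_SO2minus eps i -> B^T + B + h^T *m dlt *m h = 0 ->
  (sg *m qmat eps A i h B *m sg \in Q) =
  [&& ursubmx A == 0, lsubmx h == 0 & ulsubmx B == 0].
Proof.
move=> uA so hB; have /and3P[ui _ /eqP di] := so.
have QJ : (sg *m qmat eps A i h B *m sg)^T *m J *m (sg *m qmat eps A i h B *m sg) = J.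
  have /in_Q_char : qmat eps A i h B \in Q.
    by apply/in_QP; exists A, i, B, h.
  case=> [//|] w _.
  rewrite !trmx_mul sigma_tr -!mulmxA [sg *m (J *m _)]mulmxA [sg *m J *m _]mulmxA sigma_J.
  by rewrite [_^T *m (J *m _)]mulmxA [_^T *m J *m _]mulmxA w mulmxA sigma_J.
have hP : (h *m prl == 0) = (lsubmx h == 0).
  rewrite -[h in LHS]hsubmxK /prl mul_row_block !mx_simpl row_mx_eq0 eqxx andbT.
  by [].
have E21 (C D E : 'M[F]_(r + 1)) : prl *m C *m prr + (prl *m D + prr *m E) *m prl =
   block_mx (ulsubmx D) (ursubmx C) (dlsubmx E) 0.
  rewrite -[C in LHS]submxK -[D in LHS]submxK -[E in LHS]submxK /prl /prr.
  by rewrite !mulmx_block !mx_simpl !add_block_mx !mulmx_block !mx_simpl add_block_mx !mx_simpl.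
rewrite conj_sigma_blk in QJ *; rewrite E21 in QJ *.
apply/idP/and3P.
  case/(in_Q_char eps0) => _ [a [b [c [e [f [h' [i' [+ _]]]]]]]].
  case/blk3_inj => _ [/eqP e1 _ _] [/eqP e2 _ _].
  move: e1; rewrite block_mx_eq0 => /and4P[/eqP e1 /eqP e3 _ _].
  move: e2; rewrite -mulmxA -[0](mulmx0 _ i) (inj_eq (can_inj (mulKmx ui))) hP => hl.
  rewrite e3 hl; split=> //.
  (* Once A is lower triangular, the upper left block of A B is the product of those of A and B, and
     that of A is invertible. *)
  have : ulsubmx A *m ulsubmx B = 0.
    have := e1; rewrite -{1}[A]submxK -{1}[B]submxK e3 mulmx_block block_mxKul.
    by rewrite mul0mx addr0.
  move: uA; rewrite -[A]submxK e3 [drsubmx A]mx11_scalar lower_block_unit => /andP[uX _].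
  by rewrite block_mxKul => e4; rewrite -[ulsubmx B](mulKmx uX) e4 mulmx0.
case=> /eqP e1 /eqP e2 /eqP e3.
have AE : A = block_mx (ulsubmx A) 0 (dlsubmx A) (drsubmx A 0 0)%:M.
  by rewrite -mx11_scalar -e1 submxK.
move: uA; rewrite {1}AE lower_block_unit => /andP[uX d0].
have [w iA] := lower_block_inv (dlsubmx A) uX d0.
have z1 : ulsubmx (A *m B) = 0.
  by rewrite -{1}[A]submxK -{1}[B]submxK e1 e3 mulmx_block block_mxKul mulmx0 mul0mx addr0.
have z2 : dlsubmx (invmx A)^T = 0.
  by rewrite {1}AE iA tr_block_mx block_mxKdl trmx0.
have z3 : i *m h *m prl = 0.
  by apply/eqP; rewrite -mulmxA -[0](mulmx0 _ i) (inj_eq (can_inj (mulKmx ui))) hP e2.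
apply/(in_Q_char eps0); split; first exact: QJ.
rewrite z1 e1 z2 z3 block_mx0; do 7!eexists; split; [reflexivity | exact: di].
Qed.
End Sigma.

(** * Cardinalities *)

Section Counting.
Variables (F : finFieldType) (eps : F).
Hypotheses (char3 : 3%N \in [pchar F]) (eps0 : eps != 0) (epsN : ~~ is_square eps).
Local Notation q := (#|F|%:R : algC).
Local Notation dlt := (delta eps).

Definition skew_card (r : nat) : nat := #|[set S : 'M[F]_r | S^T == - S]|.
Definition gl_card (r : nat) : nat := #|[set A : 'M[F]_r | A \in unitmx]|.

(** The corner satisfies d = -d and therefore vanishes. *)
Lemma sum_skew_block (r : nat) (f : 'M[F]_(r + 1) -> algC) :
  \sum_(S | S^T == - S) f S =
  \sum_(X | X^T == - X) \sum_(u : 'cV_r) f (block_mx X u (- u^T) 0).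
Proof.
rewrite big_mkcond sum_block_mx [RHS]big_mkcond; apply: eq_bigr => X _.
have E (u : 'cV_r) (v : 'rV_r) (d : F) : ((block_mx X u v d%:M)^T == - block_mx X u v d%:M) =
    [&& X^T == - X, v == - u^T & d == 0].
  rewrite tr_block_mx tr_scalar_mx opp_block_mx; apply/eqP/and3P.
    case/eq_block_mx => -> vu -> /matrixP/(_ 0 0); rewrite !mxE eqxx !mulr1n => dd.
    split=> //; first by rewrite opprK.
    apply/eqP/(eq_mod3 char3 (c := d)); rewrite add0r.
    have -> : 3%:R * d = d + (d + d) by ring.
    by have -> : d + d = 0; [rewrite {1}dd addNr | rewrite addr0].
  case=> /eqP-> /eqP-> /eqP->.
  by rewrite linearN /= trmxK opprK raddf0 oppr0.
under eq_bigr => u _ do under eq_bigr => v _ do under eq_bigr => d _ do rewrite E.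
case: eqP => _ /=; last by rewrite big1 // => u _; rewrite big1 // => v _; rewrite big1.
apply: eq_bigr => u _; rewrite (bigD1 (- u^T)) //= eqxx [X in _ + X]big1 ?addr0 => [|v vu].
  rewrite (bigD1 (0 : F)) //= eqxx [X in _ + X]big1 ?addr0 => [|d /negPf -> //].
  by rewrite raddf0.
by rewrite big1 // => d _; rewrite (negPf vu).
Qed.

Lemma skew_cardE (r : nat) : skew_card r = (#|F| ^ 'C(r, 2))%N.
Proof.
apply/eqP; rewrite -(eqr_nat algC) natrX; apply/eqP.
have E s : (skew_card s)%:R = \sum_(S : 'M[F]_s | S^T == - S) 1 :> algC.
  by rewrite /skew_card cardsE -sum1_card natr_sum.
rewrite E; elim: r => [|r IH].
  rewrite (big_pred1 0) => [|S]; first by rewrite bin0n expr0.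
  by apply/eqP/eqP => _; apply/matrixP => - [].
rewrite -[r.+1]addn1 (sum_skew_block (fun=> 1)) addn1 binS bin1 exprD -IH mulr_suml.
by apply: eq_bigr => X _; rewrite sumr_const card_mx muln1 natrX mul1r.
Qed.

Lemma gl_cardE (r : nat) :
  gl_card r = (#|F| ^ 'C(r, 2) * \prod_(1 <= i < r.+1) (#|F| ^ i - 1))%N.
Proof.
case: r => [|r].
  rewrite bin0n expn0 mul1n big_geq //.
  rewrite /gl_card (eq_card (B := pred1 (0 : 'M[F]_0))) ?card1 // => A.
  rewrite !inE unitmxE det_mx00 unitr1; apply/esym/eqP/matrixP => - [] //.
rewrite -card_GL // cardsT card_sub /gl_card cardsE.
by apply: eq_card => A; rewrite !inE.
Qed.

Section Parabolic.
Variable r : nat.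
Local Notation Q := (Qset eps (r + 1)).
Local Notation sg := (@sigma F (r + 1) r).

Lemma card_Q : #|Q|%:R =
  (gl_card (r + 1))%:R * (q + 1) * q ^+ (2 * (r + 1)) * (skew_card (r + 1))%:R.
Proof.
rewrite -sum1_card natr_sum (sum_Q eps char3).
rewrite /gl_card cardsE -sum1_card natr_sum !mulr_suml; apply: eq_bigr => A _.
have -> : q + 1 = \sum_(i | in_SO2minus eps i) 1.
  rewrite natr1 -(card_SO2 char3 eps0 epsN) -sum1_card natr_sum.
  by apply: eq_bigl => i; rewrite inE.
rewrite mul1r !mulr_suml; apply: eq_bigr => i _.
have -> : \sum_(S : 'M[F]_(r + 1) | S^T == - S) 1 = (skew_card (r + 1))%:R :> algC.
  by rewrite /skew_card cardsE -sum1_card natr_sum.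
by rewrite sumr_const card_mx mul1r -natrX mulr_natl.
Qed.

Local Notation P := [set z in Q | sg *m z *m sg \in Q].

Lemma card_conj_Q : #|P|%:R =
   (gl_card r)%:R * (q - 1) * q ^+ r * (q + 1) * q ^+ 2 * q ^+ r.
Proof.
have -> : #|P|%:R = \sum_(w in Q) (if sg *m w *m sg \in Q then 1 else 0) :> algC.
  rewrite -sum1_card natr_sum -big_mkcondr; apply: eq_bigl => w; rewrite inE.
  by [].
rewrite (sum_Q eps char3).
transitivity (\sum_(A : 'M[F]_(r + 1) | A \in unitmx) \sum_(i | in_SO2minus eps i)
    \sum_(h : 'M[F]_(2, r + 1)) \sum_(S : 'M[F]_(r + 1) | S^T == - S)
   ((if ursubmx A == 0 then 1 else 0) * ((if lsubmx h == 0 then 1 else 0) * (if ulsubmx S == 0 then 1 else 0)) : algC)).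
  apply: eq_bigr => A uA; apply: eq_bigr => i so; apply: eq_bigr => h _; apply: eq_bigr => S sS.
  rewrite conj_sigma_Q //; last by rewrite skew_shift // (eqP sS) addNr.
  case: eqP => _ /=; rewrite ?mul0r ?mul1r //.
  case: eqP => [h0|_] /=; rewrite ?mul0r ?mul1r //.
  (* When the first r columns of h vanish, so does the upper left block of h^T delta h. The
     conditions on A, h and S become independent and the count factors. *)
  suff -> : ulsubmx (h^T *m dlt *m h + S) = ulsubmx S by [].
  rewrite -[X in X^T *m _ *m X]hsubmxK h0 -{1}[S]submxK.
  rewrite tr_row_mx trmx0 (mul_col_mx 0) mul0mx (mul_col_row 0) mul0mx.
  by rewrite add_block_mx block_mxKul add0r.
have cA : \sum_(A : 'M[F]_(r + 1) | A \in unitmx) (if ursubmx A == 0 then 1 else 0 : algC)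
    = (gl_card r)%:R * (q - 1) * q ^+ r.
  rewrite -big_mkcondr big_mkcond sum_block_mx /gl_card cardsE -sum1_card natr_sum.
  rewrite !mulr_suml [RHS]big_mkcond; apply: eq_bigr => X _.
  rewrite (bigD1 0) //= [X in _ + X]big1 ?addr0 => [|u u0].
    under eq_bigr => v _ do under eq_bigr => d _ do
      rewrite lower_block_unit block_mxKur eqxx andbT.
    case: ifP => [|_]; last by rewrite big1 // => v _; rewrite big1.
    rewrite unfold_in => uX.
    rewrite sumr_const card_mx mul1n -big_mkcond sumr_const (cardC1 (0 : F)) mul1r.
    by rewrite -subn1 natrB ?(card_gt0 char3) // -[LHS]mulr_natr natrX.
  rewrite big1 // => v _; rewrite big1 // => d _.
  by rewrite block_mxKur (negPf u0) andbF.
have cS : \sum_(S : 'M[F]_(r + 1) | S^T == - S) (if ulsubmx S == 0 then 1 else 0 : algC) = q ^+ r.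
  rewrite sum_skew_block.
  under eq_bigr => X _ do under eq_bigr => u _ do rewrite block_mxKul.
  rewrite (bigD1 0) ?trmx0 ?oppr0 //= [X in _ + X]big1 ?addr0 => [|X /andP[_ /negPf X0]].
    by rewrite eqxx sumr_const card_mx muln1 natrX.
  by rewrite big1 // => u _; rewrite X0.
have ch : \sum_(h : 'M[F]_(2, r + 1)) (if lsubmx h == 0 then 1 else 0 : algC) = q ^+ 2.
  rewrite sum_row_mx (bigD1 0) //= [X in _ + X]big1 ?addr0 => [|h /negPf h0].
    by under eq_bigr do rewrite row_mxKl eqxx; rewrite sumr_const card_mx natrX.
  by rewrite big1 // => h2 _; rewrite row_mxKl h0.
rewrite -cA -ch -cS !mulr_suml; apply: eq_bigr => A _.
have -> : q + 1 = \sum_(i | in_SO2minus eps i) 1.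
  rewrite natr1 -(card_SO2 char3 eps0 epsN) -sum1_card natr_sum.
  by apply: eq_bigl => i; rewrite inE.
rewrite -!mulrA mulr_suml mulr_sumr; apply: eq_bigr => i _.
rewrite mul1r mulr_suml mulr_sumr; apply: eq_bigr => h _.
by rewrite !mulr_sumr.
Qed.

(* The index of Q :&: sigma Q sigma in Q. *)
Definition coset_index : nat := (gauss1 (r + 1) #|F| * #|F| ^ (2 * r) * skew_card r)%N.

(** The quotient is formed coordinate by coordinate: A gives the Gaussian binomial, h gives q^(2r),
    S gives [skew_card r], and the factor q + 1 cancels. *)
Lemma card_Q_index : #|Q| = (coset_index * #|P|)%N.
Proof.
apply/eqP; rewrite -(eqr_nat algC) natrM card_Q card_conj_Q /coset_index !natrM !natrX.
have gS : (gl_card (r + 1))%:R = q ^+ r * ((gauss1 (r + 1) #|F|)%:R * (q - 1)) * (gl_card r)%:R.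
  have g1 : ((gauss1 (r + 1) #|F|)%:R * (q - 1)) = (#|F| ^ (r + 1) - 1)%N%:R.
    have q1 : q - 1 = (#|F| - 1)%N%:R by rewrite natrB ?(card_gt0 char3).
    rewrite q1 -natrM /gauss1 divnK // !subn1; exact: dvdn_pred_predX.
  rewrite g1 !gl_cardE addn1 binS bin1 big_nat_recr //= expnD !natrM !natrX.
  by ring.
have sS : (skew_card (r + 1))%:R = (skew_card r)%:R * q ^+ r :> algC.
  by rewrite !skew_cardE addn1 binS bin1 expnD natrM !natrX.
rewrite gS sS mulnDr muln1 exprD !exprM -!mulrA ![_ ^+ 2 ^+ r]exprAC; apply/eqP.
by ring.
Qed.

End Parabolic.
End Counting.

(** * The exponential sum over the double coset *)

Section TraceSum.
Variables (F : finFieldType) (eps : F) (r : nat).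
Hypotheses (char3 : 3%N \in [pchar F]) (eps0 : eps != 0) (epsN : ~~ is_square eps).
Local Notation q := (#|F|%:R : algC).
Local Notation dlt := (delta eps).
Local Notation Q := (Qset eps (r + 1)).
Local Notation PL := (prl F r).
Local Notation PR := (prr F r).
Local Notation sg := (@sigma F (r + 1) r).

(** A enters only through its first r rows and the last corners of A and its inverse. S pairs
    linearly with those rows, so summing over S becomes an orthogonality relation. *)
Lemma tr_qmat_sigma (A : 'M[F]_(r + 1)) i h S :
  \tr (qmat eps A i h (h^T *m dlt *m h + S) *m sg) =
  \tr (A *m PR) + \tr (invmx A *m PR) + \tr i + \tr ((PL *m A) *m (h^T *m dlt *m h)) + \tr ((PL *m A) *m S).
Proof.
rewrite sigma_blk /qmat blk3M !mx_simpl blk3_tr mxtraceD.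
have -> : \tr ((invmx A)^T *m PR) = \tr (invmx A *m PR).
  by rewrite -[LHS]mxtrace_tr trmx_mul trmxK prr_tr mxtrace_mulC.
have -> : \tr (A *m (h^T *m dlt *m h + S) *m PL) = \tr ((PL *m A) *m (h^T *m dlt *m h)) + \tr ((PL *m A) *m S).
  by rewrite mxtrace_mulC [PL *m (A *m _)]mulmxA mulmxDr mxtraceD.
ring.
Qed.

Lemma sum_Q_trace (a : F) : a != 0 ->
  \sum_(w in Q) lambda (a * \tr (w *m sg)) =
  - (Kloos (a ^+ 2) ^+ 2 * (skew_card F (r + 1))%:R * q ^+ r * q ^+ 2 * symsum eps a r).
Proof.
move=> a0; rewrite (sum_Q eps char3).
transitivity (\sum_(A : 'M[F]_(r + 1) | A \in unitmx) \sum_(i | in_SO2minus eps i)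
    lambda (a * \tr i) * (lambda (a * (\tr (A *m PR) + \tr (invmx A *m PR))) *
     (gauss_sum eps a (PL *m A) * (if (PL *m A)^T == PL *m A then (skew_card F (r + 1))%:R else 0)))).
  apply: eq_bigr => A uA; apply: eq_bigr => i so.
  set K := (if _ then _ else _); set l1 := lambda _; set l2 := lambda _.
  transitivity (\sum_(h : 'M[F]_(2, r + 1))
      l1 * (l2 * (lambda (a * \tr (PL *m A *m (h^T *m dlt *m h))) * K))); last first.
    by rewrite -mulr_sumr -mulr_sumr -mulr_suml.
  apply: eq_bigr => h _; rewrite {}/K.
  have <- : \sum_(S | S^T == - S) lambda (\tr (a *: (PL *m A) *m S)) =
     (if (PL *m A)^T == PL *m A then (skew_card F (r + 1))%:R else 0) :> algC.
    by rewrite skew_orth // linearZ /= (inj_eq (scalerI a0)).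
  set l3 := lambda _; rewrite !mulrA mulr_sumr; apply: eq_bigr => S _.
  rewrite tr_qmat_sigma /l1 /l2 /l3 -!lambdaD //; congr lambda.
  by rewrite -scalemxAl mxtraceZ; ring.
under eq_bigr => A _ do rewrite -mulr_suml (sum_SO2_lambda char3 eps0 epsN) //.
rewrite -mulr_sumr mulNr [Kloos _ ^+ 2]expr2 -!mulrA; congr (- (_ * _)).
rewrite big_mkcond sum_block_mx.
transitivity (\sum_(X : 'M[F]_r) \sum_(v : 'rV[F]_r) \sum_(d : F)
   (if (X^T == X) && (X \in unitmx) && (d != 0) then
     lambda (a * (d + d^-1)) * (gauss_sum eps a X * q ^+ 2 * (skew_card F (r + 1))%:R) else 0)).
  apply: eq_bigr => X _; rewrite (bigD1 0) //= [X in _ + X]big1 ?addr0 => [|u u0].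
    apply: eq_bigr => v _; apply: eq_bigr => d _.
    have pA : PL *m block_mx X 0 v d%:M = block_mx X 0 0 0.
      by rewrite mulmx_block !mx_simpl.
    rewrite pA tr_block_mx !trmx0 lower_block_unit.
    have -> : (block_mx X^T 0 0 0 == block_mx X 0 0 (0 : 'M_1)) = (X^T == X).
      by apply/eqP/eqP => [/eq_block_mx [] //|->].
    case: (X^T == X) => /=; last by rewrite !mulr0; case: ifP.
    case: ifP => // /andP[uX d0]; have [w ->] := lower_block_inv v uX d0.
    rewrite gauss_sum_block // !mulmx_block !mx_simpl !mxtrace_block !mxtrace0 !add0r !mxtrace_scalar !mulr1n.
    congr (_ * (_ * _ * _)).
    (* The zero block of size 1 leaves the last column of h free, whence q^2. *)
    rewrite /gauss_sum; under eq_bigr do rewrite mul0mx mxtrace0 mulr0 lambda0 //.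
    by rewrite sumr_const card_mx natrX.
  rewrite big1 // => v _; rewrite big1 // => d _.
  have pA : PL *m block_mx X u v d%:M = block_mx X u 0 0.
    by rewrite mulmx_block !mx_simpl.
  rewrite pA tr_block_mx !trmx0.
  have -> : (block_mx X^T 0 u^T 0 == block_mx X u 0 (0 : 'M_1)) = false.
    by apply/negbTE; apply: contra u0 => /eqP/eq_block_mx [_ <-].
  by rewrite !mulr0; case: ifP.
transitivity (\sum_(X : 'M[F]_r | X^T == X) Kloos (a ^+ 2) * ((skew_card F (r + 1))%:R *
    (q ^+ r * (q ^+ 2 * (if X \in unitmx then gauss_sum eps a X else 0))))); last first.
  by rewrite -!mulr_sumr [q ^+ 2]expr2 -!mulrA.
rewrite [RHS]big_mkcond; apply: eq_bigr => X _.
case: (X^T == X) => /=; last by rewrite big1 // => v _; rewrite big1.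
case: (X \in unitmx) => /=; last by rewrite !mulr0 big1 // => v _; rewrite big1.
(* The free row v gives q^r; the corner d and its inverse give the second Kloosterman sum. *)
rewrite sumr_const card_mx mul1n -big_mkcond -mulr_suml -Kloos_sqr //.
by rewrite -[LHS]mulr_natl natrX; ring.
Qed.

Local Notation N := #|DC2 eps (r + 1)|.

(** In [double_coset_tr] the order of Q is the index times that of its intersection with sigma Q
    sigma; cancelling the latter leaves the index. *)
Lemma DC2_sum (phi : F -> algC) :
  \sum_(g in DC2 eps (r + 1)) phi (\tr g) =
  (coset_index F r)%:R * \sum_(w in Q) phi (\tr (w *m sg)).
Proof.
have Q0 : #|Q|%:R != 0 :> algC.
  by rewrite pnatr_eq0 -lt0n; apply/card_gt0P; exists 1%:M; apply: Q_1.
have uQ : {in Q, forall x, x \in unitmx} by move=> x; apply: Q_unit.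
have mQ : {in Q &, forall x y, x *m y \in Q} by move=> x y; apply: Q_mul.
have oQ : 1%:M \in Q by apply: Q_1.
have e := double_coset_tr uQ mQ oQ (sigma_sigma F r) phi.
have P0 := Q0; rewrite (card_Q_index char3 eps0 epsN r) natrM mulf_eq0 negb_or in P0.
case/andP: P0 => c0 P0; apply: (mulfI P0).
have r1 : (r + 1).-1 = r by rewrite addn1.
rewrite /DC2 r1 -e (card_Q_index char3 eps0 epsN r) natrM.
ring.
Qed.

Lemma DC2_card : N = (coset_index F r * #|Q|)%N.
Proof.
apply/eqP; rewrite -(eqr_nat algC) natrM -!sum1_card !natr_sum; apply/eqP.
exact: (DC2_sum (fun=> 1)).
Qed.

End TraceSum.

(** * Closed forms *)

Section ClosedForms.
Variable F : finFieldType.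
Hypothesis char3 : 3%N \in [pchar F].
Local Notation q := (#|F|).

Definition even_prod (k : nat) : nat := (\prod_(1 <= j < k.+1) (q ^ (2 * j) - 1))%N.

Lemma prod_parity k :
  (\prod_(1 <= i < (2 * k).+1) (q ^ i - 1) = odd_prod F k * even_prod k)%N.
Proof.
elim: k => [|k IH]; first by rewrite /odd_prod /even_prod muln0 !big_geq.
have -> : (2 * k.+1 = (2 * k).+2)%N by lia.
rewrite big_nat_recr //= big_nat_recr //= IH /odd_prod /even_prod.
rewrite [in RHS]big_nat_recr //= [X in (_ = _ * X)%N]big_nat_recr //=.
have -> : (2 * k.+1 - 1 = (2 * k).+1)%N by lia.
have -> : (2 * k.+1 = (2 * k).+2)%N by lia.
by ring.
Qed.

(** Later C(r,2) is generalised to a variable c, and this relation lets [lia] compare exponents of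
    q. *)
Lemma bin2_sqr r : ('C(r, 2) * 2 + r = r * r)%N.
Proof. by elim: r => // r IH; rewrite binS bin1; lia. Qed.

Lemma coset_indexE r :
  coset_index F r = (gauss1 r.+1 q * q ^ (2 * r + 'C(r, 2)))%N.
Proof. by rewrite /coset_index addn1 skew_cardE // -mulnA -expnD. Qed.

(** With n = 2k + 2 the truncated subtractions and the division by 4 in the exponent are exact. *)
Lemma A2_even k :
  A2 (2 * k).+2 q = (q ^ (5 * (k * k) + 9 * k + 2) * gauss1 (2 * k).+1 q * odd_prod F k)%N.
Proof.
rewrite /A2 /= !oddM /= /A2plus.
have -> : ((2 * k).+2 - 1 = (2 * k).+1)%N by lia.
have -> : (((2 * k).+2 - 2) %/ 2 = k)%N by lia.
by have -> : ((5 * (2 * k).+2 ^ 2 - 2 * (2 * k).+2 - 8) %/ 4 = 5 * (k * k) + 9 * k + 2)%N by rewrite -mulnn; lia.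
Qed.

Lemma B2_even k :
  B2 (2 * k).+2 q = ((q + 1) * q ^ (k * k) * (q ^ (2 * k).+1 - 1) * even_prod k)%N.
Proof.
rewrite /B2 /= !oddM /= /B2plus.
have -> : ((2 * k).+2 - 1 = (2 * k).+1)%N by lia.
have -> : (((2 * k).+2 - 2) %/ 2 = k)%N by lia.
by have -> : (((2 * k).+2 - 2) ^ 2 %/ 4 = k * k)%N by rewrite -mulnn; lia.
Qed.

Lemma A2_odd k :
  A2 (2 * k).+3 q = (q ^ (5 * (k * k) + 13 * k + 7) * gauss1 (2 * k).+2 q * odd_prod F k.+1)%N.
Proof.
rewrite /A2 /= !oddM /= /A2minus.
have -> : ((2 * k).+3 - 1 = (2 * k).+2)%N by lia.
have -> : ((2 * k).+2 %/ 2 = k.+1)%N by lia.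
by have -> : ((5 * (2 * k).+3 ^ 2 - 4 * (2 * k).+3 - 5) %/ 4 = 5 * (k * k) + 13 * k + 7)%N by rewrite -mulnn; lia.
Qed.

Lemma B2_odd k :
  B2 (2 * k).+3 q = ((q + 1) * q ^ (k.+1 * k.+1) * even_prod k.+1)%N.
Proof.
rewrite /B2 /= !oddM /= /B2minus.
have -> : (((2 * k).+3 - 1) %/ 2 = k.+1)%N by lia.
by have -> : (((2 * k).+3 - 1) ^ 2 %/ 4 = k.+1 * k.+1)%N by rewrite -mulnn; lia.
Qed.

Variable eps : F.
Hypotheses (eps0 : eps != 0) (epsN : ~~ is_square eps).

Lemma half_cases r : exists k, r = (2 * k)%N \/ r = (2 * k).+1.
Proof. by exists r./2; have := odd_double_half r; case: (odd r) => <-; [right | left]; lia. Qed.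

(** For r even the order of GL(r+1,q) has an odd number of factors q^i - 1; the unpaired q^(n-1) - 1
    is the extra factor of B in the plus case. *)
Lemma DC2_card_closed r : #|DC2 eps (r + 1)| = (A2 r.+2 q * B2 r.+2 q)%N.
Proof.
rewrite DC2_card // coset_indexE.
have -> : #|Qset eps (r + 1)| = (gl_card F (r + 1) * (q + 1) * q ^ (2 * (r + 1)) * skew_card F (r + 1))%N.
  apply/eqP; rewrite -(eqr_nat algC) (card_Q char3 eps0 epsN) !natrM natrX natrD.
  by [].
rewrite [(r + 1)%N]addn1 gl_cardE // skew_cardE // binS bin1 [('C(r, 2) + r)%N]addnC.
have := bin2_sqr r; move: ('C(r, 2)) => c.
have [k [->|->]] := half_cases r => hc.
  rewrite A2_even B2_even big_nat_recr //= prod_parity.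
  have e : (q ^ (5 * (k * k) + 9 * k + 2) * q ^ (k * k) =
    q ^ (2 * (2 * k) + c) * q ^ (2 * k + c) * q ^ (2 * (2 * k).+1) * q ^ (2 * k + c))%N.
    by rewrite -!expnD; congr (_ ^ _)%N; lia.
  set E := (odd_prod F k); set E' := even_prod k; set G := gauss1 _ _; set W := (_ - 1)%N.
  transitivity (q ^ (2 * (2 * k) + c) * q ^ (2 * k + c) * q ^ (2 * (2 * k).+1) * q ^ (2 * k + c)
     * (G * E * E' * W * (q + 1)))%N; first by ring.
  by rewrite -e; ring.
rewrite A2_odd B2_odd.
have e2 : ((2 * k).+2 = 2 * k.+1)%N by lia.
rewrite e2 prod_parity.
have e : (q ^ (5 * (k * k) + 13 * k + 7) * q ^ (k.+1 * k.+1) =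
  q ^ (2 * (2 * k).+1 + c) * q ^ ((2 * k).+1 + c) * q ^ (2 * (2 * k.+1)) * q ^ ((2 * k).+1 + c))%N.
  by rewrite -!expnD; congr (_ ^ _)%N; lia.
set E := (odd_prod F k.+1); set E' := even_prod k.+1; set G := gauss1 _ _.
transitivity (q ^ (2 * (2 * k).+1 + c) * q ^ ((2 * k).+1 + c) * q ^ (2 * (2 * k.+1)) * q ^ ((2 * k).+1 + c)
   * (G * E * E' * (q + 1)))%N; first by ring.
by rewrite -e; ring.
Qed.

(** The sign is that of the symmetric sum of size r = n - 2, which has the parity of n. *)
Lemma DC2_lambda_sum r (a : F) : a != 0 ->
  \sum_(g in DC2 eps (r + 1)) lambda (a * \tr g) =
  - ((-1) ^+ odd r * (A2 r.+2 q)%:R * Kloos (a ^+ 2) ^+ 2).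
Proof.
move=> a0; rewrite (DC2_sum r char3 eps0 epsN (fun x => lambda (a * x))) sum_Q_trace //.
rewrite coset_indexE skew_cardE // addn1 binS bin1 [('C(r, 2) + r)%N]addnC.
have := bin2_sqr r; move: ('C(r, 2)) => c.
have [k [->|->]] := half_cases r => hc.
  have [-> _] := symsum_closed char3 eps0 epsN a0 k.
  rewrite A2_even !oddM /= expr0 mul1r !natrM !natrX.
  have e : (#|F|%:R ^+ (5 * (k * k) + 9 * k + 2) = #|F|%:R ^+ (2 * (2 * k) + c) *
     #|F|%:R ^+ (2 * k + c) * #|F|%:R ^+ (2 * k) * #|F|%:R ^+ 2 * #|F|%:R ^+ (2 * k) * #|F|%:R ^+ (k * k.+1) :> algC).
    by rewrite -!exprD; congr (_ ^+ _); lia.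
  by rewrite e; ring.
have [_ ->] := symsum_closed char3 eps0 epsN a0 k.
rewrite A2_odd /= !oddM /= expr1 !natrM !natrX.
have e : (#|F|%:R ^+ (5 * (k * k) + 13 * k + 7) = #|F|%:R ^+ (2 * (2 * k).+1 + c) *
   #|F|%:R ^+ ((2 * k).+1 + c) * #|F|%:R ^+ (2 * k).+1 * #|F|%:R ^+ 2 * #|F|%:R ^+ (2 * k).+1 * #|F|%:R ^+ (k * k.+1) :> algC).
  by rewrite -!exprD; congr (_ ^+ _); lia.
by rewrite e; ring.
Qed.
End ClosedForms.

(** * The recursion *)

Section Weights.
Variables (F : finFieldType) (eps : F) (r : nat).
Hypotheses (char3 : 3%N \in [pchar F]) (eps0 : eps != 0) (epsN : ~~ is_square eps).
Local Notation D := (DC2 eps (r + 1)).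
Local Notation A := ((A2 r.+2 #|F|)%:R : algC).
Local Notation B := ((B2 r.+2 #|F|)%:R : algC).
Local Notation wt := (trace_weight D (fun g => \tr g)).

Lemma codeC_weight j : codeC eps (r + 1) j = code_weight D (fun g => \tr g) j.
Proof. by apply: eq_card => u; rewrite !inE andbA. Qed.

(** Averaging the three characters of F_3 counts the g of trace zero, N minus the weight. The sums
    for a and -a agree, as they depend on a^2 only. *)
Lemma trace_weight_DC2 (a : F) : a != 0 ->
  (wt a)%:R = 2%:R / 3%:R * A * (B + (-1) ^+ odd r * Kloos (a ^+ 2) ^+ 2).
Proof.
move=> a0.
have e : \sum_(g in D) (1 + lambda (a * \tr g) + lambda (- (a * \tr g))) =
    3%:R * (#|D|%:R - (wt a)%:R).
  under eq_bigr do rewrite lambda_sum_pm //.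
  rewrite -(cardsID [set g | abstr (a * \tr g) != 0] D) natrD.
  have -> : #|D :&: [set g | abstr (a * \tr g) != 0]| = wt a.
    by apply: eq_card => g; rewrite !inE.
  rewrite [(wt a)%:R + _]addrC addrK -big_mkcondr sumr_const -[LHS]mulr_natr; congr (_ * _%:R).
  by apply: eq_card => g; rewrite !inE negbK andbC unfold_in /=.
move: e; rewrite !big_split /= sumr_const.
have -> : \sum_(g in D) lambda (- (a * \tr g)) = \sum_(g in D) lambda (- a * \tr g).
  by apply: eq_bigr => g _; rewrite mulNr.
rewrite !DC2_lambda_sum ?oppr_eq0 // sqrrN DC2_card_closed // natrM.
move: (_ ^+ odd r) (Kloos _ ^+ 2) => s K e.
have three0 : (3%:R : algC) != 0 by rewrite pnatr_eq0.
apply: (mulfI three0).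
have -> : 3%:R * (wt a)%:R = 3%:R * (A * B) - 3%:R * (A * B - (wt a)%:R) :> algC by ring.
by rewrite -e; field.
Qed.

Lemma trace_weight0 : wt 0 = 0%N.
Proof.
apply/eqP; rewrite cards_eq0; apply/eqP/setP => g.
by rewrite !inE mul0r abstr0 // eqxx andbF.
Qed.

(** A nonzero square has exactly the roots z and -z, distinct because 2 is invertible. *)
Lemma sum_squares (f : F -> algC) :
  \sum_(a | a != 0) f (a ^+ 2) = 2%:R * \sum_(b | (b != 0) && is_square b) f b.
Proof.
rewrite (partition_big (fun a => a ^+ 2) (fun b => (b != 0) && is_square b)) /=; last first.
  by move=> a a0; rewrite expf_neq0 //; apply/existsP; exists a.
rewrite mulr_sumr; apply: eq_bigr => b /andP[b0 /existsP[z /eqP bz]].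
rewrite (eq_bigr (fun _ => f b)) => [|a /andP[_ /eqP ->] //].
rewrite sumr_const mulr_natl; congr (_ *+ _).
have z0 : z != 0 by apply: contraNneq b0 => z0; rewrite bz z0 expr0n.
have nz : z != - z.
  apply: contra z0 => /eqP e; apply/eqP/(eq_mod3 char3 (c := z)); rewrite add0r.
  have -> : 3%:R * z = z + (z + z) by ring.
  by rewrite {3}e addNr addr0.
rewrite -[RHS]/((true : nat).+1) -nz -cards2; apply: eq_card => a.
rewrite !inE unfold_in /= bz eqf_sqr; apply: andb_idl.
by case/orP => /eqP ->; rewrite ?oppr_eq0.
Qed.

End Weights.

Unset Implicit Arguments.

Theorem theorem1 (F : finFieldType) (eps : F) (n : nat) :
  3%N \in [pchar F] ->
  eps != 0 -> ~~ is_square eps ->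
  (2 <= n)%N ->
  let q := #|F| in
  let A := A2 n q in
  let B := B2 n q in
  let N := #|DC2 eps n.-1| in
  let eta : algC := if odd n then -1 else 1 in
  N = (A * B)%N /\
  forall h : nat, (1 <= h)%N ->
    eta ^+ h * @SK F (2 * h) =
      - (\sum_(l < h) eta ^+ l * ('C(h, l))%:R * (B%:R) ^+ (h - l) * @SK F (2 * l))
      + q%:R * (A%:R) ^- h *
        \sum_(j < (minn N h).+1)
          (-1) ^+ j * (codeC eps n.-1 j)%:R *
          \sum_(j <= t < h.+1)
            t`!%:R * stirling2 h t * 3%:R ^+ (h - t) *
            (2%:R : algC) ^ (t%:Z - h%:Z - j%:Z - 1) *
            (if (t <= N)%N then ('C(N - j, N - t))%:R else 0).
Proof.
move=> char3 eps0 epsN; case: n => [|[|r]] // _ q A B N eta.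
have r1 : r.+2.-1 = (r + 1)%N by rewrite addn1.
rewrite /N r1 {r1 N}.
have etaE : eta = (-1) ^+ odd r by rewrite /eta /= negbK; case: (odd r).
split; first exact: DC2_card_closed.
move=> h h1.
have pm := @power_moment F char3 _ (DC2 eps (r + 1)) (fun g => \tr g) h.
set M := (X in _ * X) in pm.
have -> : \sum_(j < (minn #|DC2 eps (r + 1)| h).+1)
     (-1) ^+ j * (codeC eps (r + 1) j)%:R *
     \sum_(j <= t < h.+1) t`!%:R * stirling2 h t * 3%:R ^+ (h - t) *
        (2%:R : algC) ^ (t%:Z - h%:Z - j%:Z - 1) *
        (if (t <= #|DC2 eps (r + 1)|)%N then ('C(#|DC2 eps (r + 1)| - j, #|DC2 eps (r + 1)| - t))%:R else 0) = M.
  by apply: eq_bigr => j _; rewrite codeC_weight.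
(* N = A B is positive because the double coset contains sigma. *)
have A0 : (A%:R : algC) != 0.
  have : (0 < #|DC2 eps (r + 1)|)%N.
    apply/card_gt0P; exists (1%:M *m sigma (r + 1) (r + 1).-1 *m 1%:M).
    by apply: imset2_f; apply: Q_1.
  by rewrite DC2_card_closed // muln_gt0 pnatr_eq0 -lt0n => /andP[].
have two0 : (2%:R : algC) != 0 by rewrite pnatr_eq0.
have three0 : (3%:R : algC) != 0 by rewrite pnatr_eq0.
(* Extended by the term l = h, the sum in the recursion is the h-th moment of B + eta K(b)^2 over
   the nonzero squares b. *)
have binom : \sum_(l < h.+1) eta ^+ l * ('C(h, l))%:R * (B%:R) ^+ (h - l) * @SK F (2 * l) =
   \sum_(b : F | (b != 0) && is_square b) (B%:R + eta * Kloos b ^+ 2) ^+ h.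
  under [RHS]eq_bigr do rewrite exprDn.
  rewrite exchange_big /=; apply: eq_bigr => l _; rewrite /SK mulr_sumr.
  apply: eq_bigr => b _; rewrite exprMn -exprM -[RHS]mulr_natr; ring.
have main : \sum_(b : F | (b != 0) && is_square b) (B%:R + eta * Kloos b ^+ 2) ^+ h =
    q%:R * A%:R ^- h * M.
  (* The term a = 0 has weight 0 and drops out because h is positive. *)
  move: pm; rewrite (bigD1 0) //= (trace_weight0 eps r char3) expr0n (gtn_eqF h1) add0r.
  under eq_bigr => a a0 do rewrite trace_weight_DC2 // exprMn exprMn -etaE.
  rewrite -mulr_sumr (sum_squares char3 (fun b => (B%:R + eta * Kloos b ^+ 2) ^+ h)) => pm.
  have c0 : 2%:R * (2%:R / 3%:R) ^+ h * A%:R ^+ h != 0 :> algC.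
    by rewrite !mulf_neq0 ?expf_neq0 ?mulf_neq0 ?invr_eq0.
  apply: (mulfI c0).
  transitivity ((2%:R / 3%:R) ^+ h * A%:R ^+ h * (2%:R *
     \sum_(b : F | (b != 0) && is_square b) (B%:R + eta * Kloos b ^+ 2) ^+ h)); first by ring.
  by rewrite pm; field; rewrite expf_neq0.
rewrite -main -binom big_ord_recr /= subnn binn expr0 !mulr1.
by rewrite addrA addNr add0r.
Qed.
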